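(* Let $X$ be a random variable in $\mathbb{R}^d$ with $\|X\|_{L_2}<\infty$. For $T>0$ let $X_T=X+B_T$ with $B_T\sim\mathcal{N}(0,TI)$ independent of $X$, and let $\hat X_0\sim\mathcal{N}(0,TI)$. Then $$W_2(\mathcal{L}(X_T),\mathcal{L}(\hat X_0))\le W_2(\mathcal{L}(X),\delta_0)=\|X\|_{L_2}.$$ Suppose moreover that $X\in B(0,R)$ almost surely, for some $R>0$, and $\mathbb{E}[X]=0$. Let $\Sigma=\mathbb{E}[XX^\top]$. Then, as $T\to+\infty$, $W_2(\mathcal{L}(X_T),\mathcal{L}(\hat X_0))\sim\frac12\frac{\|\Sigma\|_{\mathrm F}}{\sqrt T}$, in the sense that $$\sqrt T\; W_2(\mathcal{L}(X_T),\mathcal{L}(\hat X_0))\longrightarrow\frac12\|\Sigma\|_{\mathrm F}.$$ In particular, there exists $T_0$ depending only on $\mathcal{L}(X)$ such that for all $T\ge T_0$, $$W_2(\mathcal{L}(X_T),\mathcal{L}(\hat X_0))\le\frac{R^2}{\sqrt T}.$$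
   Context: $\mathcal{L}(Y)$ is the law of $Y$; $\|Y\|_{L_2}=(\mathbb{E}\|Y\|^2)^{1/2}$; $W_2$ is the Wasserstein-2 distance on $\mathbb{R}^d$ for the Euclidean norm; $\|\cdot\|_{\mathrm F}$ is the Frobenius norm; $B(0,R)$ is the closed Euclidean ball; $\delta_0$ is the Dirac mass at $0$. *)

(* Defs.v *)
(* Built on MathComp-Analysis. *)
From HB Require Import structures.
From mathcomp Require Import all_boot all_order all_algebra.
From mathcomp Require Import all_classical all_reals all_analysis.
From mathcomp Require Import measurable_realfun.

Set Implicit Arguments.
Unset Strict Implicit.
Unset Printing Implicit Defensive.

Import Order.TTheory GRing.Theory Num.Theory.
Import numFieldNormedType.Exports.

Local Open Scope classical_set_scope.
Local Open Scope ring_scope.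

(* R^n is the type of column vectors, with the sigma-algebra generated by the
   coordinates, i.e. the Borel one; this is the construction the library uses
   for tuples. *)
Definition measure_colvec_display : measure_display.
Proof. exact: default_measure_display. Qed.

Section measurable_colvec.
Variables (R : realType) (n : nat).

Definition colvec_coord (i : 'I_n) (x : 'cV[R]_n) : R := x i ord0.

Let colvec_set0 : g_sigma_preimage colvec_coord set0.
Proof. exact: sigma_algebra0. Qed.

Let colvec_setC A :
  g_sigma_preimage colvec_coord A -> g_sigma_preimage colvec_coord (~` A).
Proof. exact: sigma_algebraC. Qed.

Let colvec_bigcup (F : (set 'cV[R]_n)^nat) :
  (forall i, g_sigma_preimage colvec_coord (F i)) ->
  g_sigma_preimage colvec_coord (\bigcup_i (F i)).
Proof. exact: sigma_algebra_bigcup. Qed.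

HB.instance Definition _ := @isMeasurable.Build measure_colvec_display
  'cV[R]_n (g_sigma_preimage colvec_coord)
  colvec_set0 colvec_setC colvec_bigcup.

Lemma measurable_colvec_coord (i : 'I_n) :
  measurable_fun [set: 'cV[R]_n] (colvec_coord i).
Proof.
move=> _ Y mY; rewrite setTI; apply: sub_sigma_algebra => /=.
rewrite -bigcup_seq/=; exists i => /=; first by rewrite mem_index_enum.
by exists Y => //; rewrite setTI.
Qed.

Lemma measurable_fun_colvecP d (T : measurableType d) (f : T -> 'cV[R]_n) :
  measurable_fun [set: T] f <->
  forall i, measurable_fun [set: T] (fun w => f w i ord0).
Proof.
split=> [mf i|mf].
  exact: (measurableT_comp (measurable_colvec_coord i) mf).
suff : preimage_set_system [set: T] f (g_sigma_preimage colvec_coord)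
    `<=` measurable.
  by move=> h _ A mA; apply: h; exists A.
rewrite -g_sigma_preimage_comp.
apply: smallest_sub; first exact: sigma_algebra_measurable.
rewrite -bigcup_seq; apply: bigcup_sub => i _ A [B mB <-].
exact: (mf i).
Qed.

End measurable_colvec.

Section random_vectors.
Context d (T : measurableType d) (R : realType) (P : probability T R).
Variable n : nat.
Implicit Types X Y : {RV P >-> 'cV[R]_n}.

Definition rv_add X Y : T -> 'cV[R]_n := fun w => X w + Y w.

Let measurable_rv_add X Y : measurable_fun [set: T] (rv_add X Y).
Proof.
apply/measurable_fun_colvecP => i; rewrite /rv_add.
under eq_fun do rewrite mxE.
by apply: measurable_funD; move: i; apply/measurable_fun_colvecP.
Qed.

HB.instance Definition _ X Y :=
  isMeasurableFun.Build _ _ T 'cV[R]_n (rv_add X Y) (measurable_rv_add X Y).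

(* Equality of laws is only required on measurable sets: the values of a
   measure on the other sets are arbitrary. *)
Definition has_law X (mu : set 'cV[R]_n -> \bar R) : Prop :=
  forall A, measurable A -> distribution P X A = mu A.

Definition indep X Y : Prop :=
  forall A B, measurable A -> measurable B ->
    P (X @^-1` A `&` Y @^-1` B) = (P (X @^-1` A) * P (Y @^-1` B))%E.

(* Y ~ N(0, t I), for t > 0: the coordinates of Y are independent and each is
   N(0, t). The second parameter of normal_prob is the standard deviation. *)
Definition is_gaussian Y (t : R) : Prop :=
  forall A : 'I_n -> set R, (forall i, measurable (A i)) ->
    P [set w | forall i, A i (Y w i ord0)] =
    \big[*%E/1%E]_(i < n) normal_prob 0 (Num.sqrt t) (A i).

End random_vectors.

Notation "X \+v Y" := (rv_add X Y) (at level 50, left associativity).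

(* The norm `|x| of the library on matrices is the sup norm. *)
Definition enorm (R : realType) n (x : 'cV[R]_n) : R :=
  Num.sqrt (\sum_i x i ord0 ^+ 2).

Definition frobenius (R : realType) m n (M : 'M[R]_(m, n)) : R :=
  Num.sqrt (\sum_i \sum_j M i j ^+ 2).

(* Entrywise expectation; meaningful when all the entries are integrable. *)
Definition expectation_mx d (T : measurableType d) (R : realType)
    (P : probability T R) m n (M : T -> 'M[R]_(m, n)) : 'M[R]_(m, n) :=
  \matrix_(i, j) fine 'E_P[fun w => M w i j].

Definition L2norm d (T : measurableType d) (R : realType)
    (P : probability T R) n (X : T -> 'cV[R]_n) : \bar R :=
  sqrte 'E_P[fun w => enorm (X w) ^+ 2].

Definition coupling (R : realType) n (mu nu : probability 'cV[R]_n R) :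
    set (probability ('cV[R]_n * 'cV[R]_n)%type R) :=
  [set pi | forall A, measurable A ->
     pi (fst @^-1` A) = mu A /\ pi (snd @^-1` A) = nu A].

Definition W2 (R : realType) n (mu nu : probability 'cV[R]_n R) : \bar R :=
  sqrte (ereal_inf
    [set (\int[pi]_z (enorm (z.1 - z.2) ^+ 2)%:E)%E | pi in coupling mu nu]).

(* Main.v *)
Require Import Defs.
From HB Require Import structures.
From mathcomp Require Import all_boot all_order all_algebra.
From mathcomp Require Import all_classical all_reals all_analysis.
From mathcomp Require Import measurable_realfun.
From mathcomp Require Import ring lra.

Set Implicit Arguments.
Unset Strict Implicit.
Unset Printing Implicit Defensive.

Import Order.TTheory GRing.Theory Num.Theory.
Import numFieldNormedType.Exports.

Local Open Scope classical_set_scope.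
Local Open Scope ring_scope.

(** Throughout, Y is a sample of N(0, t I), so that X + Y has the law of X_t.

    Upper bound. Let Y_s have the law of Y + s X. Given Y_s, resample X' from
    the conditional law of X given Y + s X = Y_s, which is explicit since the
    law of Y + s X has a density with respect to that of Y (Cameron-Martin).
    Then Y_s + h X' has exactly the law of Y + (s + h) X. Iterating from s = 0 to s = 1
    with step h = 1 / N couples Y with X + Y. In the L2 norm of the total
    displacement, the conditional means contribute at most the sum of the
    h |E[X | Y + s X]|, while the centred parts are orthogonal and
    contribute O(r / sqrt N). Hence
    W_2 is at most the integral of |E[X | Y + s X]| over s in [0, 1]. If X1
    and X2 are independent copies of X, then E |E[X | Y + s X]|^2 is at most
    E[<X1, X2> exp(s^2 <X1, X2> / t)] / (1 - r^2 / 2t), and since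
    E <X1, X2> = 0 and E <X1, X2>^2 = |Sigma|_F^2, this is
    s^2 |Sigma|_F^2 / t + O(t^-2). Integrating over s gives
    |Sigma|_F / (2 sqrt t) + O(1 / t).

    Lower bound. The quadratic form of Sigma has expectation larger by
    |Sigma|_F^2 at X + Y than at Y, and for any coupling the difference is
    at most W_2 times the L2 norm of Sigma (X + Y) + Sigma Y, about
    2 sqrt t |Sigma|_F.

    Explicit threshold. |Sigma|_F <= E |X|^2 <= r^2 for every r bounding X,
    so half of E |X|^2 is spare when comparing the limit with r^2, and it
    absorbs the error terms for t beyond a threshold depending on the law of X. *)

(** * Integration against densities, and measures on column vectors determined by rectangles *)

Section density.
Local Open Scope ereal_scope.
Context d (T : measurableType d) (R : realType).
Implicit Type m : {measure set T -> \bar R}.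
Import HBNNSimple.

(** Both sides are monotone limits along simple approximations of [g], and on an indicator they
    agree by the hypothesis on [nu]. *)
Lemma ge0_integral_density m (nu : {measure set T -> \bar R}) (f : T -> R)
    (g : T -> \bar R) :
  measurable_fun [set: T] f -> (forall x, (0 <= f x)%R) ->
  (forall A, measurable A -> nu A = \int[m]_(x in A) (f x)%:E) ->
  measurable_fun [set: T] g -> (forall x, 0 <= g x) ->
  \int[nu]_x g x = \int[m]_x ((f x)%:E * g x).
Proof.
move=> mf0 f0' nuE mg g0.
have mf : measurable_fun [set: T] (EFin \o f) by exact/measurable_EFinP.
have f0 x : 0 <= (f x)%:E by rewrite lee_fin.
pose h := nnsfun_approx measurableT mg.
have gE x : g x = limn (fun n => (h n x)%:E).
  by apply/esym/cvg_lim => //; exact: cvg_nnsfun_approx.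
have fgE x : (f x)%:E * g x = limn (fun n => (f x)%:E * (h n x)%:E).
  apply/esym/cvg_lim => //.
  by apply: cvgeZl => //; exact: cvg_nnsfun_approx.
under eq_integral do rewrite gE.
rewrite monotone_convergence//; last 3 first.
- by move=> n; exact/measurable_EFinP.
- by move=> n x _; rewrite lee_fin.
- by move=> x _ a b ab; rewrite lee_fin; exact/lefP/nd_nnsfun_approx.
under [RHS]eq_integral do rewrite fgE.
rewrite monotone_convergence//; last 3 first.
- by move=> n; apply: emeasurable_funM => //; exact/measurable_EFinP.
- by move=> n x _; rewrite mule_ge0// lee_fin.
- move=> x _ a b ab; rewrite lee_wpmul2l// lee_fin.
  exact/lefP/nd_nnsfun_approx.
congr (limn _); apply/funext => n.
have mI k : measurable (h n @^-1` [set k]) by exact: measurable_sfunP.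
transitivity (\sum_(k \in range (h n)) (k%:E * nu (h n @^-1` [set k]))).
  by rewrite integral_nnsfun// patch_setT sintegralE.
transitivity (\sum_(k \in range (h n))
    \int[m]_x ((f x)%:E * (k * \1_(h n @^-1` [set k]) x)%:E)); last first.
  rewrite -ge0_integral_fsum//; last 2 first.
  - move=> k; apply: emeasurable_funM => //.
    by apply/measurable_EFinP; exact: measurable_funM.
  - by move=> k x _; rewrite mule_ge0// nnfun_muleindic_ge0.
  apply: eq_integral => x _; rewrite [in RHS]fimfunE -fsumEFin//.
  by rewrite ge0_mule_fsumr// => k; exact: nnfun_muleindic_ge0.
(* Levels [k < 0] have empty preimage; the others may be pulled out of the integral as nonnegative
   scalars. *)
apply: eq_fsbigr => k _; rewrite nuE//.
have [k0|k0] := leP 0%R k; last first.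
  rewrite preimage_nnfun0// integral_set0 mule0 integral0_eq// => x _.
  by rewrite indicE in_set0 mulr0 mule0.
transitivity (\int[m]_x (k%:E * ((EFin \o f) \_ (h n @^-1` [set k])) x)).
  rewrite ge0_integralZl_EFin//.
  - by congr (_ * _); rewrite [LHS]integral_mkcond.
  - by move=> x _; rewrite patchE; case: ifP => _ //=; rewrite lee_fin.
  - by apply/(measurable_restrictT _ _).1 => //; exact: measurable_funTS.
apply: eq_integral => x _; rewrite patchE indicE.
by case: ifPn => _; rewrite /= ?mulr1 ?mulr0 ?mule0// muleC.
Qed.

End density.

Section density_probability.
Local Open Scope ereal_scope.
Context d d' (T : measurableType d) (T' : measurableType d') (R : realType).
Variables (m : {measure set T -> \bar R}) (f : T -> R) (phi : T -> T').
Hypothesis mf : measurable_fun [set: T] f.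
Hypothesis f0 : forall x, (0 <= f x)%R.
Hypothesis f1 : \int[m]_x (f x)%:E = 1.

Let D A := \int[m]_(x in A) (f x)%:E.

Let D0 : D set0 = 0. Proof. exact: integral_set0. Qed.

Let D_ge0 A : 0 <= D A.
Proof. by apply: integral_ge0 => x _; rewrite lee_fin. Qed.

Let D_sigma_additive : semi_sigma_additive D.
Proof.
move=> F mF tF mUF; rewrite /D ge0_integral_bigcup//.
- apply: is_cvg_ereal_nneg_natsum_cond => n _ _.
  by apply: integral_ge0 => x _; rewrite lee_fin.
- by apply/measurable_EFinP; exact: measurable_funTS.
- by move=> x _; rewrite lee_fin.
Qed.

#[local] HB.instance Definition _ := isMeasure.Build _ _ _ D D0 D_ge0 D_sigma_additive.
#[local] HB.instance Definition _ := @Measure_isProbability.Build _ _ R D f1.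

(** Reweighting by [f] and pushing forward along [phi] builds both tilted laws and the couplings of
    the interpolation. The measure is known only through its action on nonnegative functions, which
    is the form consumed later. *)
Lemma exists_density_pushforward : measurable_fun [set: T] phi ->
  exists Q : probability T' R, forall g : T' -> \bar R,
    measurable_fun [set: T'] g -> (forall x, 0 <= g x) ->
    \int[Q]_y g y = \int[m]_x ((f x)%:E * g (phi x)).
Proof.
move=> mphi.
pose phi' : {mfun T >-> T'} := HB.pack phi (isMeasurableFun.Build _ _ _ _ _ mphi).
exists (distribution (D : probability T R) phi') => g mg g0.
rewrite ge0_integral_distribution//.
apply: (ge0_integral_density (nu := D : probability T R)) => //; [exact: measurableT_comp | move=> x; exact: g0].
Qed.

End density_probability.

Section colvec_unique.
Context (R : realType) (n : nat).
Notation V := 'cV[R]_n.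

Lemma measurable_rect (A : 'I_n -> set R) : (forall i, measurable (A i)) ->
  measurable [set y : V | forall i, A i (y i ord0)].
Proof.
move=> mA; rewrite (_ : mkset _ = \bigcap_(i in setT) ((@colvec_coord R n i) @^-1` (A i))).
  apply: (@fin_bigcap_measurable _ V) => [|i _]; first exact: finite_finset.
  by rewrite -[X in measurable X]setTI; exact: measurable_colvec_coord.
by apply/seteqP; split => [y h i _|y h i]; exact: h.
Qed.

(** Rectangles are stable under intersection and generate the sigma-algebra. Hence [is_gaussian],
    which only speaks of rectangles, determines a law. *)
Lemma colvec_measure_unique (m1 m2 : {measure set V -> \bar R}) :
  (m1 setT < +oo)%E ->
  (forall A : 'I_n -> set R, (forall i, measurable (A i)) ->
     m1 [set y : V | forall i, A i (y i ord0)] = m2 [set y : V | forall i, A i (y i ord0)]) ->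
  forall A, measurable A -> m1 A = m2 A.
Proof.
move=> m1oo m12 A mA.
pose G : set (set V) := [set B | exists2 A : 'I_n -> set R,
  (forall i, measurable (A i)) & B = [set y : V | forall i, A i (y i ord0)]].
have GT : G setT by exists (fun=> setT) => //; apply/seteqP; split.
apply: (measure_unique G (fun=> setT)) => //.
- rewrite [LHS]/measurable/= /g_sigma_preimage eqEsubset; split.
    apply: smallest_sub; first exact: smallest_sigma_algebra.
    rewrite -bigcup_seq; apply: bigcup_sub => i _ B [C mC <-].
    apply: sub_sigma_algebra.
    exists (fun j => if j == i then C else setT).
      by move=> j; case: ifP.
    rewrite setTI; apply/seteqP; split => y /=.
      by move=> Cy j; case: eqP => [->|].
    by move=> /(_ i); rewrite eqxx.
  apply: smallest_sub; first exact: sigma_algebra_measurable.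
  move=> B [C mC ->].
  exact: measurable_rect.
- move=> _ _ [B mB ->] [C mC ->]; exists (fun i => B i `&` C i).
    by move=> i; exact: measurableI.
  apply/seteqP; split => y /=.
    by move=> [h k] i; split.
  by move=> h; split => i; case: (h i).
- by rewrite bigcup_const.
- by move=> B [C mC ->]; exact: m12.
Qed.

End colvec_unique.

(** * The Euclidean inner product *)

Section dot.
Context (R : realType) (n : nat).
Implicit Types x y z : 'cV[R]_n.

Definition dot x y : R := \sum_i x i ord0 * y i ord0.

Lemma dotC x y : dot x y = dot y x.
Proof. by apply: eq_bigr => i _; rewrite mulrC. Qed.

Lemma dotDl x y z : dot (x + y) z = dot x z + dot y z.
Proof. by rewrite -big_split/=; apply: eq_bigr => i _; rewrite mxE mulrDl. Qed.

Lemma dotZl k x z : dot (k *: x) z = k * dot x z.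
Proof. by rewrite mulr_sumr; apply: eq_bigr => i _; rewrite mxE mulrA. Qed.

Lemma dotDr x y z : dot z (x + y) = dot z x + dot z y.
Proof. by rewrite !(dotC z) dotDl. Qed.

Lemma dotZr k x z : dot z (k *: x) = k * dot z x.
Proof. by rewrite !(dotC z) dotZl. Qed.

Lemma dotNl x z : dot (- x) z = - dot x z.
Proof. by rewrite -scaleN1r dotZl mulN1r. Qed.

Lemma dotNr x z : dot z (- x) = - dot z x.
Proof. by rewrite !(dotC z) dotNl. Qed.

Lemma dot0l z : dot 0 z = 0.
Proof. by rewrite -(scale0r z) dotZl mul0r. Qed.

Lemma dot_ge0 x : 0 <= dot x x.
Proof. by apply: sumr_ge0 => i _; rewrite -expr2 sqr_ge0. Qed.

Lemma enorm_sqr x : enorm x ^+ 2 = dot x x.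
Proof.
rewrite /enorm sqr_sqrtr; last by apply: sumr_ge0 => i _; exact: sqr_ge0.
by apply: eq_bigr => i _; rewrite expr2.
Qed.

Definition dotE := (dotDl, dotDr, dotZl, dotZr, dotNl, dotNr).

(** The squared norm of [k *: x - y] is nonnegative; divide by [k]. *)
Lemma dot_young k x y : 0 < k -> 2 * dot x y <= k * dot x x + k^-1 * dot y y.
Proof.
move=> k0; have := dot_ge0 (k *: x - y); rewrite !dotE (dotC y x) => h.
have kV : 0 < k^-1 by rewrite invr_gt0.
have : 0 <= k^-1 * (k * (k * dot x x) - k * dot x y - (k * dot x y - dot y y)).
  by rewrite mulr_ge0// ?ltW//; lra.
rewrite !mulrBr !mulrA mulVf ?gt_eqF// !mul1r; lra.
Qed.

Lemma dot_cauchy_schwarz x y : dot x y ^+ 2 <= dot x x * dot y y.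
Proof.
have [y0|y0] := eqVneq (dot y y) 0.
  have h k : 0 <= dot x x + 2 * k * dot x y.
    have := dot_ge0 (x + k *: y); rewrite !dotE (dotC y x) y0; lra.
  suff -> : dot x y = 0 by rewrite expr0n/= y0 mulr0.
  apply: contrapT => /eqP xy0.
  (* With [dot y y = 0] the expansion [h] is affine in [k], and this value of [k] would make it
     equal to -1. *)
  have := h (- (dot x x + 1) / (2 * dot x y)).
  suff -> : 2 * (- (dot x x + 1) / (2 * dot x y)) * dot x y = - (dot x x + 1) by lra.
  by field.
have yp : 0 < dot y y by rewrite lt_neqAle eq_sym y0 dot_ge0.
(* The component of [x] orthogonal to [y], scaled by [dot y y] to avoid a division. *)
have := dot_ge0 (dot y y *: x - dot x y *: y); rewrite !dotE (dotC y x) => h.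
rewrite -subr_ge0 -(pmulr_rge0 _ yp); lra.
Qed.

Lemma abs_coord_le x i r : 0 <= r -> dot x x <= r ^+ 2 -> `|x i ord0| <= r.
Proof.
move=> r0 h; rewrite -(ler_pXn2r (n:=2))// ?nnegrE// real_normK ?num_real//.
apply: le_trans h; rewrite /dot (bigD1 i)//= -expr2 lerDl.
by apply: sumr_ge0 => j _; rewrite -expr2 sqr_ge0.
Qed.

End dot.

Section measurable_dot.
Context d (T : measurableType d) (R : realType) (n : nat).
Implicit Types f g : T -> 'cV[R]_n.

Lemma measurable_fun_coord f i : measurable_fun [set: T] f ->
  measurable_fun [set: T] (fun w => f w i ord0).
Proof. by move=> /measurable_fun_colvecP. Qed.

Lemma measurable_dot f g : measurable_fun [set: T] f -> measurable_fun [set: T] g ->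
  measurable_fun [set: T] (fun w => dot (f w) (g w)).
Proof.
move=> mf mg; apply: measurable_sum => i.
by apply: measurable_funM; exact: measurable_fun_coord.
Qed.

Lemma measurable_addv f g : measurable_fun [set: T] f -> measurable_fun [set: T] g ->
  measurable_fun [set: T] (fun w => f w + g w).
Proof.
move=> mf mg; apply/measurable_fun_colvecP => i.
under eq_fun do rewrite mxE.
by apply: measurable_funD; exact: measurable_fun_coord.
Qed.

Lemma measurable_scalev (k : T -> R) f : measurable_fun [set: T] k ->
  measurable_fun [set: T] f -> measurable_fun [set: T] (fun w => k w *: f w).
Proof.
move=> mk mf; apply/measurable_fun_colvecP => i.
under eq_fun do rewrite mxE.
by apply: measurable_funM => //; exact: measurable_fun_coord.
Qed.

Lemma measurable_oppv f : measurable_fun [set: T] f ->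
  measurable_fun [set: T] (fun w => - f w).
Proof.
move=> mf; apply/measurable_fun_colvecP => i.
under eq_fun do rewrite mxE.
by apply: measurableT_comp => //; exact: measurable_fun_coord.
Qed.

Lemma measurable_mulmxv m (M : 'M[R]_(m, n)) f : measurable_fun [set: T] f ->
  measurable_fun [set: T] (fun w => M *m f w).
Proof.
move=> mf; apply/measurable_fun_colvecP => i.
under eq_fun do rewrite mxE.
by apply: measurable_sum => j; apply: measurable_funM => //; exact: measurable_fun_coord.
Qed.

End measurable_dot.

(** * Gaussian tilting *)

Section cameron_martin.
Context (R : realType).

(** The translated measure gives every half-open interval its length, which characterises Lebesgue
    measure. *)
Lemma ge0_lebesgue_integral_translate (c : R) (g : R -> \bar R) :
  measurable_fun [set: R] g -> (forall x, 0 <= g x)%E ->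
  (\int[lebesgue_measure]_x g (x + c)%R = \int[lebesgue_measure]_x g x)%E.
Proof.
move=> mg g0.
have mD : measurable_fun [set: R] (fun x : R => x + c : measurableTypeR R).
  by apply: measurable_funD.
transitivity (\int[pushforward lebesgue_measure (fun x : R => (x + c)%R : measurableTypeR R)]_x g x)%E.
  by rewrite ge0_integral_pushforward.
apply: eq_measure_integral => //= A mA _.
apply/esym/lebesgue_measure_unique => //= _ [[a b]] _ <-.
rewrite /pushforward (_ : _ @^-1` _ = `]a - c, b - c]%classic); last first.
  apply/seteqP; split => x /=; rewrite !in_itv/=; lra.
rewrite !lebesgue_measure_itv/= !lte_fin ltrD2r.
by case: ifP => // _; rewrite -!EFinD; congr EFin; lra.
Qed.

Lemma ge0_integral_normal_prob (s : R) (g : R -> \bar R) :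
  measurable_fun [set: R] g -> (forall x, 0 <= g x)%E ->
  (\int[normal_prob 0 s]_x g x =
   \int[lebesgue_measure]_x ((normal_pdf 0 s x)%:E * g x))%E.
Proof.
move=> mg g0; apply: (@ge0_integral_density _ _ _ _ (normal_prob 0 s : probability _ R)) => //.
- exact: measurable_normal_pdf.
- by move=> x; exact: normal_pdf_ge0.
Qed.

(** Translate the left-hand integral by [c] and complete the square: density times tilt, taken at
    [x + c], is the density at [x]. *)
Lemma normal_tilt (s c : R) (g : R -> \bar R) : 0 < s ->
  measurable_fun [set: R] g -> (forall x, 0 <= g x)%E ->
  (\int[normal_prob 0 s]_x ((expR ((c * x - 2^-1 * c ^+ 2) / s ^+ 2))%:E * g x) =
   \int[normal_prob 0 s]_x g (x + c)%R)%E.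
Proof.
move=> s0 mg g0.
have ms : measurable_fun [set: R] (fun x => x + c) by exact: measurable_funD.
rewrite !ge0_integral_normal_prob//; last 3 first.
- exact: (measurableT_comp mg).
- apply: emeasurable_funM => //; apply/measurable_EFinP.
  apply: measurableT_comp => //; apply: measurable_funM => //.
  by apply: measurable_funD => //; exact: measurable_funM.
- by move=> x; rewrite mule_ge0// lee_fin expR_ge0.
rewrite -(@ge0_lebesgue_integral_translate c); last 2 first.
- apply: emeasurable_funM; first by apply/measurable_EFinP; exact: measurable_normal_pdf.
  apply: emeasurable_funM => //; apply/measurable_EFinP.
  apply: measurableT_comp => //; apply: measurable_funM => //.
  by apply: measurable_funD => //; exact: measurable_funM.
- by move=> x; rewrite !mule_ge0// lee_fin ?expR_ge0// normal_pdf_ge0.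
apply: eq_integral => x _; rewrite muleA -EFinM; congr (_%:E * _)%E.
rewrite !normal_pdfE ?gt_eqF//= /normal_fun -mulrA -expRD; congr (_ * expR _).
by field; rewrite gt_eqF.
Qed.

Context (n : nat).
Notation V := 'cV[R]_n.

(* [is_gaussian], for a measure instead of a random vector. *)
Definition gaussian_law (t : R) (gam : set V -> \bar R) : Prop :=
  forall A : 'I_n -> set R, (forall i, measurable (A i)) ->
    gam [set y : V | forall i, A i (y i ord0)] =
    (\big[*%E/1%E]_(i < n) normal_prob 0 (Num.sqrt t) (A i))%E.

(* The density of N(a, t I) with respect to N(0, t I). *)
Definition tilt (t : R) (a y : V) : R := expR ((dot a y - 2^-1 * dot a a) / t).

Lemma tilt_gt0 t a y : 0 < tilt t a y. Proof. exact: expR_gt0. Qed.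

Lemma tilt_ge0 t a y : 0 <= tilt t a y. Proof. exact: expR_ge0. Qed.

Lemma measurable_tilt d (T : measurableType d) t (f g : T -> V) :
  measurable_fun [set: T] f -> measurable_fun [set: T] g ->
  measurable_fun [set: T] (fun w => tilt t (f w) (g w)).
Proof.
move=> mf mg; apply: measurableT_comp => //; apply: measurable_funM => //.
apply: measurable_funB; first exact: measurable_dot.
by apply: measurable_funM => //; exact: measurable_dot.
Qed.

(** Cocycle identity: tilting by [a + b] is tilting by [a], then by [b] in the frame shifted by [a].
    It is what lets translations be composed. *)
Lemma tiltDE t a b y : tilt t (a + b) y = tilt t a y * tilt t b (y - a).
Proof.
rewrite /tilt -expRD -mulrDl.
suff -> : dot (a + b) y - 2^-1 * dot (a + b) (a + b) =
  dot a y - 2^-1 * dot a a + (dot b (y - a) - 2^-1 * dot b b) by [].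
rewrite !dotE (dotC b a); lra.
Qed.

(** The translate of [gam] by [a] has density [tilt t a] with respect to [gam]. Quantifying over
    nonnegative [g] allows a tilt to be traded for a shift directly under an integral. *)
Definition cameron_martin t (gam : {measure set V -> \bar R}) (a : V) : Prop :=
  forall g : V -> \bar R, measurable_fun [set: V] g -> (forall y, 0 <= g y)%E ->
    (\int[gam]_y ((tilt t a y)%:E * g y) = \int[gam]_y g (y + a)%R)%E.

Lemma measurable_shift (a : V) : measurable_fun [set: V] (fun y => y + a).
Proof. by apply: measurable_addv. Qed.

Lemma cameron_martinD t gam a b : cameron_martin t gam a -> cameron_martin t gam b ->
  cameron_martin t gam (a + b).
Proof.
move=> ha hb g mg g0.
under eq_integral do rewrite tiltDE EFinM -muleA.
rewrite (ha (fun y => (tilt t b (y - a))%:E * g y)%E); last 2 first.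
- apply: emeasurable_funM => //; apply/measurable_EFinP.
  by apply: measurable_tilt => //; exact: measurable_shift.
- by move=> y; rewrite mule_ge0// lee_fin tilt_ge0.
under eq_integral do rewrite addrK.
rewrite (hb (fun y => g (y + a)%R)); last 2 first.
- by apply: (measurableT_comp mg); exact: measurable_shift.
- by [].
by apply: eq_integral => y _; rewrite -addrA (addrC b).
Qed.

Variables (t : R) (gam : probability V R).
Hypotheses (t0 : 0 < t) (gamE : gaussian_law t gam).

(** Independence of the coordinates: once the others are confined to their sides of a rectangle,
    coordinate [i0] is still normal, up to a constant factor. *)
Lemma gaussian_slice (i0 : 'I_n) (A : 'I_n -> set R) (g : R -> \bar R) :
  (forall i, measurable (A i)) ->
  measurable_fun [set: R] g -> (forall x, 0 <= g x)%E ->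
  (\int[gam]_y ((\1_[set y : V | forall i, i != i0 -> A i (y i ord0)] y)%:E * g (y i0 ord0)) =
   \big[*%E/1]_(i < n | i != i0) normal_prob 0 (Num.sqrt t) (A i) *
   \int[normal_prob 0 (Num.sqrt t)]_x g x)%E.
Proof.
move=> mA mg g0.
set D := [set y : V | _]; set C := (\big[_/_]_(_ < _ | _) _)%E.
have rectE B : D `&` (colvec_coord i0 @^-1` B) =
    [set y : V | forall i, (if i == i0 then B else A i) (y i ord0)].
  apply/seteqP; split => y /=.
    by move=> [Dy By] i; case: eqP => [->//|/eqP]; exact: Dy.
  move=> h; split; last by have := h i0; rewrite eqxx.
  by move=> i ii0; have := h i; rewrite (negbTE ii0).
have mcoord : measurable_fun [set: V] (colvec_coord i0) by exact: measurable_colvec_coord.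
have mD : measurable D.
  have := @measurable_rect R n (fun i => if i == i0 then setT else A i).
  rewrite -rectE preimage_setT setIT; apply=> i; by case: ifP.
have [c c0 CE] : exists2 c, 0 <= c & C = c%:E.
  rewrite /C; elim/big_ind: _ => [|_ _ [x x0 ->] [y y0 ->]|i _].
  - by exists 1.
  - by exists (x * y); rewrite ?mulr_ge0.
  - exists (fine (normal_prob 0 (Num.sqrt t) (A i))); first exact: fine_ge0.
    rewrite fineK//; apply: (fin_num_measure (normal_prob 0 (Num.sqrt t) : probability _ R)).
    exact: mA.
transitivity (\int[mrestr gam mD]_y g (colvec_coord i0 y))%E.
  apply/esym/ge0_integral_density => //.
  - by move=> A' mA'; rewrite integral_indic// setIC.
  - exact: (measurableT_comp mg).
pose RR : measurableType _ := measurableTypeR R.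
have mc' : measurable_fun [set: V] (colvec_coord i0 : V -> RR) by exact: mcoord.
have mg' : measurable_fun [set: RR] g by exact: mg.
pose ci0 : {mfun V >-> RR} := HB.pack (colvec_coord i0 : V -> RR)
   (isMeasurableFun.Build _ _ _ _ _ mc').
transitivity (\int[pushforward (mrestr gam mD) ci0]_x g x)%E.
  by rewrite ge0_integral_pushforward.
transitivity (\int[normal_prob 0 (Num.sqrt t)]_x (c%:E * g x))%E; last first.
  by rewrite ge0_integralZl_EFin// CE.
apply: (@ge0_integral_density _ RR R (normal_prob 0 (Num.sqrt t)) (pushforward (mrestr gam mD) ci0) (cst c)) => //.
move=> B mB; transitivity (c%:E * normal_prob 0 (Num.sqrt t) B)%E; last first.
  by rewrite -(integral_cst (normal_prob 0 (Num.sqrt t)) mB).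
rewrite [LHS](_ : _ = gam (D `&` (colvec_coord i0 @^-1` B))); last by rewrite setIC.
rewrite rectE; have -> := gamE (A := fun i => if i == i0 then B else A i); last first.
  by move=> i; case: ifP.
rewrite (bigD1 i0)//= eqxx muleC -CE; congr (_ * _)%E.
by apply: eq_bigr => i /negbTE ->.
Qed.

(** The tilted measure and the translated one are compared on rectangles, where only the factor [i0]
    changes and [normal_tilt] applies; rectangles determine both measures. *)
Lemma cameron_martin_coord i0 (c : R) :
  cameron_martin t gam (c *: delta_mx i0 ord0).
Proof.
set a := _ *: _.
have ai i : a i ord0 = if i == i0 then c else 0.
  by rewrite /a !mxE eqxx andbT; case: eqP => _; rewrite ?mulr1 ?mulr0.
have dota y : dot a y = c * y i0 ord0.
  rewrite /dot (bigD1 i0)//= ai eqxx big1 ?addr0// => i /negbTE ii0.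
  by rewrite ai ii0 mul0r.
have yaE (y : V) i : (y + a) i ord0 = y i ord0 + a i ord0 by rewrite [LHS]mxE.
pose g (x : R) := (expR ((c * x - 2^-1 * c ^+ 2) / t))%:E.
have mg : measurable_fun [set: R] g.
  apply/measurable_EFinP; apply: measurableT_comp => //; apply: measurable_funM => //.
  by apply: measurable_funD => //; exact: measurable_funM.
have g0 x : (0 <= g x)%E by rewrite lee_fin expR_ge0.
have tiltE y : (tilt t a y)%:E = g (y i0 ord0).
  by rewrite /tilt /g !dota ai eqxx expr2.
have mtilt : measurable_fun [set: V] (tilt t a) by exact: measurable_tilt.
pose phi : {mfun V >-> V} := HB.pack (fun y : V => y + a)
   (isMeasurableFun.Build _ _ _ _ _ (measurable_shift a)).
have rect (A : 'I_n -> set R) : (forall i, measurable (A i)) ->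
    (\int[gam]_y ((tilt t a y)%:E * (\1_[set y : V | forall i, A i (y i ord0)] y)%:E) =
     distribution gam phi [set y : V | forall i, A i (y i ord0)])%E.
  move=> mA; set S := [set y : V | _].
  have mAc i : measurable [set x | A i (x + a i ord0)].
    rewrite -[X in measurable X]setTI.
    by apply: (measurable_funD (@measurable_id _ _ setT) (measurable_cst _)).
  transitivity (\int[gam]_y
    ((\1_[set y : V | forall i, i != i0 -> A i (y i ord0)] y)%:E *
     (g (y i0 ord0) * (\1_(A i0) (y i0 ord0))%:E)))%E.
    apply: eq_integral => y _; rewrite tiltE muleCA; congr (_ * _)%E.
    rewrite -EFinM !indicE -natrM mulnb; congr ((nat_of_bool _)%:R%:E).
    apply/idP/andP; rewrite !inE.
      by move=> Sy; split => [i _|]; exact: Sy.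
    by move=> [/= Ay Ay0] i; have [->//|] := eqVneq i i0; exact: Ay.
  rewrite (@gaussian_slice i0 A (fun x => (g x * (\1_(A i0) x)%:E)%E))//; last 2 first.
  - apply: emeasurable_funM => //; apply/measurable_EFinP; exact: measurable_indic.
  - by move=> x; rewrite mule_ge0// lee_fin.
  have -> : (\int[normal_prob 0 (Num.sqrt t)]_x (g x * (\1_(A i0) x)%:E) =
      \int[normal_prob 0 (Num.sqrt t)]_x (\1_(A i0) (x + c)%R)%:E)%E.
    rewrite -(@normal_tilt (Num.sqrt t) c (EFin \o \1_(A i0))) ?sqrtr_gt0//.
    - by rewrite sqr_sqrtr// ltW.
    - by apply/measurable_EFinP; exact: measurable_indic.
    - by move=> x; rewrite lee_fin.
  rewrite [RHS]/distribution /pushforward [X in gam X](_ : _ = [set y : V | forall i,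
    [set x | A i (x + a i ord0)] (y i ord0)]); last first.
    by apply/seteqP; split => y h i; have := h i; rewrite /= yaE.
  have -> := gamE (A := fun i => [set x | A i (x + a i ord0)]); last by [].
  rewrite [RHS](bigD1 i0)//= muleC; congr (_ * _)%E.
    rewrite -[X in normal_prob _ _ X]setIT -integral_indic//.
      by apply: eq_integral => x _; rewrite !indicE ai eqxx.
    exact: mAc.
  apply: eq_bigr => i /negbTE ii0; congr (normal_prob _ _ _).
  by apply/seteqP; split => x /=; rewrite ai ii0 addr0.
(* The rectangle identity with all sides full shows that the tilt is a probability density, so that
   the tilted measure exists. *)
have one : (\int[gam]_y (tilt t a y)%:E = 1)%E.
  transitivity (distribution gam phi [set y : V | forall i : 'I_n, [set: R] (y i ord0)]).
    rewrite -(rect (fun=> setT))//; apply: eq_integral => y _.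
    by rewrite indicE mem_set//= mule1.
  by rewrite -(probability_setT (distribution gam phi)); congr (distribution _ _ _); apply/seteqP.
have [Q QE] := exists_density_pushforward mtilt (fun y => tilt_ge0 t a y) one (@measurable_id _ V setT).
have QE' A : measurable A -> Q A = distribution gam phi A.
  apply: colvec_measure_unique.
    exact: (eq_ind_r (fun x => (x < +oo)%E) (ltry 1) (probability_setT Q)).
  move=> {}A mA; apply: (eq_trans _ (rect A mA)).
  rewrite -[in LHS](setIT [set y : V | forall i, A i (y i ord0)]).
  rewrite -integral_indic//; last exact: measurable_rect.
  rewrite QE//.
  by apply/measurable_EFinP; apply: measurable_indic; exact: measurable_rect.
move=> f mf f0; rewrite -QE//.
transitivity (\int[distribution gam phi]_y f y)%E; last by rewrite ge0_integral_distribution.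
by apply: eq_measure_integral => A mA _; exact: QE'.
Qed.

(** A vector is the sum of its components along the axes, and the property is stable under sums. *)
Lemma gaussian_cameron_martin a : cameron_martin t gam a.
Proof.
rewrite (matrix_sum_delta a).
under eq_bigr do rewrite big_ord_recl big_ord0 addr0.
elim/big_ind: _ => [|b c hb hc|i _].
- move=> g mg g0; apply: eq_integral => y _.
  by rewrite addr0 /tilt !dot0l mulr0 subrr mul0r expR0 mul1e.
- exact: cameron_martinD.
- exact: cameron_martin_coord.
Qed.

End cameron_martin.

(** * Interpolation between N(0, t I) and its convolution with the law of X *)

Lemma measurable_invr_ge0 d (T : measurableType d) (R : realType) (f : T -> R) :
  measurable_fun [set: T] f -> (forall x, 0 <= f x) ->
  measurable_fun [set: T] (fun x => (f x)^-1).
Proof.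
move=> mf f0; under eq_fun do rewrite -powR_inv1//.
exact: (measurableT_comp (measurable_powR _)).
Qed.

Section bounded_functions.
Context d (E : measurableType d) (R : realType) (mu : probability E R).

(** This class is closed under the algebraic operations used below and is integrable for every
    probability, which settles the integrability conditions on functions of [X]. *)
Definition bounded_mfun (h : E -> R) : Prop :=
  measurable_fun [set: E] h /\ exists M, forall w, `|h w| <= M.

Lemma bounded_mfun_cst c : bounded_mfun (fun=> c).
Proof. by split => //; exists `|c|. Qed.

Lemma bounded_mfunD f g : bounded_mfun f -> bounded_mfun g ->
  bounded_mfun (fun w => f w + g w).
Proof.
move=> [mf [M fM]] [mg [N gN]]; split; first exact: measurable_funD.
by exists (M + N) => w; rewrite (le_trans (ler_normD _ _))// lerD.
Qed.

Lemma bounded_mfunM f g : bounded_mfun f -> bounded_mfun g ->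
  bounded_mfun (fun w => f w * g w).
Proof.
move=> [mf [M fM]] [mg [N gN]]; split; first exact: measurable_funM.
by exists (M * N) => w; rewrite normrM ler_pM.
Qed.

Lemma bounded_mfunN f : bounded_mfun f -> bounded_mfun (fun w => - f w).
Proof.
move=> [mf [M fM]]; split; first exact: measurableT_comp.
by exists M => w; rewrite normrN.
Qed.

Lemma bounded_mfun_sum (I : Type) (s : seq I) (f : I -> E -> R) :
  (forall i, bounded_mfun (f i)) -> bounded_mfun (fun w => \sum_(i <- s) f i w).
Proof.
move=> hf; elim: s => [|i s ih].
  by under eq_fun do rewrite big_nil; exact: bounded_mfun_cst.
by under eq_fun do rewrite big_cons; exact: bounded_mfunD.
Qed.

Lemma bounded_mfun_integrable f : bounded_mfun f -> mu.-integrable setT (EFin \o f).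
Proof.
move=> [mf [M fM]]; apply: (@measurable_bounded_integrable _ _ _ mu f) => //.
  exact: (eq_ind_r (fun x => (x < +oo)%E) (ltry 1) (probability_setT mu)).
exists M; split; first exact: num_real.
by move=> x Mx w _ /=; rewrite (le_trans (fM w))// ltW.
Qed.

Lemma Rintegral_cstP c : \int[mu]_w c = c.
Proof.
rewrite Rintegral_cst// -[RHS]mulr1; congr (_ * _).
exact: (congr1 fine (probability_setT mu)).
Qed.

Lemma Rintegral_sumB (I : Type) (s : seq I) (f : I -> E -> R) :
  (forall i, bounded_mfun (f i)) ->
  \int[mu]_w (\sum_(i <- s) f i w) = \sum_(i <- s) \int[mu]_w f i w.
Proof.
move=> hf; elim: s => [|i s ih].
  under eq_Rintegral do rewrite big_nil.
  by rewrite Rintegral_cstP big_nil.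
under eq_Rintegral do rewrite big_cons.
rewrite RintegralD//; [|exact: bounded_mfun_integrable|].
  by rewrite ih big_cons.
by apply: bounded_mfun_integrable; exact: bounded_mfun_sum.
Qed.

Lemma EFin_Rintegral f : bounded_mfun f ->
  ((\int[mu]_w f w)%:E = \int[mu]_w (f w)%:E)%E.
Proof.
by move=> hf; rewrite /Rintegral fineK//; exact/integrable_fin_num/bounded_mfun_integrable.
Qed.

End bounded_functions.

Section step.
Context (R : realType) (n : nat) (t : R) (gam : probability 'cV[R]_n R).
Context d (E : measurableType d) (mu : probability E R) (X : E -> 'cV[R]_n) (r : R).
Notation V := 'cV[R]_n.
Hypotheses (t0 : 0 < t) (CM : forall a, cameron_martin t gam a).
Hypotheses (mX : measurable_fun [set: E] X) (r0 : 0 < r).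
Hypothesis Xr : forall w, dot (X w) (X w) <= r ^+ 2.
Hypothesis X0 : forall i, \int[mu]_w (X w i ord0) = 0.
Hypothesis rt : 2 * r ^+ 2 <= t.

Let bX i : bounded_mfun (fun w => X w i ord0).
Proof.
split; first exact: measurable_fun_coord.
by exists r => w; apply: abs_coord_le => //; exact: ltW.
Qed.

Let weight s (y : V) w := tilt t (s *: X w) y.

Let weight_gt0 s y w : 0 < weight s y w. Proof. exact: tilt_gt0. Qed.

Let measurable_weight s : measurable_fun [set: V * E] (fun p => weight s p.1 p.2).
Proof.
apply: measurable_tilt => //; apply: measurable_scalev => //.
exact: (measurableT_comp mX).
Qed.

Let bweight s y : bounded_mfun (weight s y).
Proof.
split; first by apply: measurable_tilt => //; exact: measurable_scalev.
exists (expR (2^-1 * dot y y / t)) => w; rewrite ger0_norm ?tilt_ge0//.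
rewrite ler_expR ler_wpM2r ?invr_ge0 ?(ltW t0)//.
by have := @dot_young _ _ 1 (s *: X w) y ltr01; rewrite invr1 !mul1r; lra.
Qed.

(* With [h := 1] this is the density at y of the law of Y + s X with respect
   to that of Y; in general, its product with E[h | Y + s X = y]. *)
Definition tilt_mean s (h : E -> R) (y : V) : R := \int[mu]_w (tilt t (s *: X w) y * h w).

(** Tonelli gives measurability for nonnegative functions; a signed [h] bounded by [M] is the
    difference of [h + M] and [M]. *)
Lemma measurable_tilt_mean s h : bounded_mfun h -> measurable_fun [set: V] (tilt_mean s h).
Proof.
move=> bh; have [mh [M hM]] := bh.
have pos (k : E -> R) : measurable_fun [set: E] k -> (forall w, 0 <= k w) ->
    measurable_fun [set: V] (tilt_mean s k).
  move=> mk k0; apply: (measurableT_comp (@fine_measurable R _ measurableT)).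
  apply: (measurable_fun_fubini_tonelli_F (m2 := mu) (fun p => (weight s p.1 p.2 * k p.2)%:E)) => /=.
    apply/measurable_EFinP; apply: measurable_funM => //.
    exact: (measurableT_comp mk).
  by move=> p; rewrite lee_fin mulr_ge0// ltW.
have -> : tilt_mean s h = (fun y => tilt_mean s (fun w => h w + M) y - tilt_mean s (fun=> M) y).
  apply/funext => y; rewrite /tilt_mean -RintegralB//.
  - by apply: eq_Rintegral => w _; lra.
  - apply/bounded_mfun_integrable/bounded_mfunM; first exact: bweight.
    by apply: bounded_mfunD => //; exact: bounded_mfun_cst.
  - apply/bounded_mfun_integrable/bounded_mfunM; first exact: bweight.
    exact: bounded_mfun_cst.
apply: measurable_funB; apply: pos => //.
- exact: measurable_funD.
- by move=> w; have := hM w; rewrite ler_norml; lra.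
- by move=> w; rewrite (le_trans _ (hM w)).
Qed.

Definition tilt_mass s y := tilt_mean s (fun=> 1) y.

(** Since [exp z >= 1 + z], the tilt is at least one plus a term linear in [X], of mean zero, minus
    [s^2 |X|^2 / 2t]. As [2 r^2 <= t], the bound is positive and dividing by [tilt_mass] is
    legitimate. *)
Lemma tilt_mass_ge s y : 0 <= s <= 1 -> 1 - r ^+ 2 / (2 * t) <= tilt_mass s y.
Proof.
move=> /andP[s0 s1].
have bl : bounded_mfun (fun w => \sum_i (s / t * y i ord0) * X w i ord0).
  by apply: bounded_mfun_sum => i; apply: bounded_mfunM => //; exact: bounded_mfun_cst.
rewrite (_ : 1 - _ = \int[mu]_w (1 - r ^+ 2 / (2 * t) + \sum_i (s / t * y i ord0) * X w i ord0)).
  apply: le_Rintegral => //.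
  - apply: bounded_mfun_integrable; apply: bounded_mfunD => //; exact: bounded_mfun_cst.
  - apply/bounded_mfun_integrable/bounded_mfunM; first exact: bweight.
    exact: bounded_mfun_cst.
  move=> w _; rewrite mulr1 /tilt (le_trans _ (expR_ge1Dx _))//.
  rewrite -addrA lerD2l.
  have -> : \sum_i s / t * y i ord0 * X w i ord0 = s * dot (X w) y / t.
    rewrite /dot mulr_sumr mulr_suml; apply: eq_bigr => i _; ring.
  rewrite !dotE mulrBl addrC lerD2l lerNl opprK.
  rewrite [leRHS](_ : _ = 2^-1 * r ^+ 2 / t); last by field; rewrite gt_eqF.
  rewrite ler_wpM2r ?invr_ge0 ?(ltW t0)// ler_wpM2l// ?invr_ge0//.
  rewrite mulrA (le_trans _ (Xr w))// ler_piMl ?dot_ge0//.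
  by rewrite mulr_ile1.
rewrite RintegralD//; last 2 first.
- by apply: bounded_mfun_integrable; exact: bounded_mfun_cst.
- exact: bounded_mfun_integrable.
rewrite Rintegral_cstP Rintegral_sumB; last first.
  by move=> i; apply: bounded_mfunM => //; exact: bounded_mfun_cst.
rewrite big1 ?addr0// => i _.
by rewrite RintegralZl ?X0 ?mulr0//; exact: bounded_mfun_integrable.
Qed.

Let c_gt0 : 0 < 1 - r ^+ 2 / (2 * t).
Proof.
have t2 : 0 < 2 * t by move: t0; lra.
rewrite subr_gt0 ltr_pdivrMr// mul1r.
by move: (sqr_ge0 r) t0 rt; lra.
Qed.

Lemma tilt_mass_gt0 s y : 0 <= s <= 1 -> 0 < tilt_mass s y.
Proof. by move=> s01; exact: lt_le_trans (tilt_mass_ge y s01). Qed.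

Lemma bounded_mfun_tilt s y h : bounded_mfun h ->
  bounded_mfun (fun w => tilt t (s *: X w) y * h w).
Proof. by move=> bh; apply: (bounded_mfunM _ bh); exact: bweight. Qed.

Lemma EFin_tilt_mass s y : ((tilt_mass s y)%:E = \int[mu]_w (tilt t (s *: X w) y)%:E)%E.
Proof.
rewrite /tilt_mass /tilt_mean EFin_Rintegral.
  by apply: eq_integral => w _; rewrite mulr1.
by apply: bounded_mfun_tilt; exact: bounded_mfun_cst.
Qed.

Lemma measurable_tilt_mass s : measurable_fun [set: V] (tilt_mass s).
Proof. apply: (@measurable_tilt_mean s (fun=> 1)); exact: bounded_mfun_cst. Qed.

(** Tonelli exchanges the integrals, then Cameron-Martin trades the weight for a shift by
    [s *: X w]. *)
Lemma tilted_fubini s (k : V -> E -> \bar R) :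
  measurable_fun [set: V * E] (fun p => k p.1 p.2) -> (forall y w, 0 <= k y w)%E ->
  (\int[gam]_y \int[mu]_w ((tilt t (s *: X w) y)%:E * k y w) =
   \int[mu]_w \int[gam]_y k (y + s *: X w)%R w)%E.
Proof.
move=> mk k0.
rewrite (fubini_tonelli (m1 := gam) (m2 := mu)
  (fun p => (tilt t (s *: X p.2) p.1)%:E * k p.1 p.2)%E)/=; last 2 first.
- by apply: emeasurable_funM => //; apply/measurable_EFinP; exact: measurable_weight.
- by move=> p; rewrite mule_ge0// lee_fin tilt_ge0.
apply: eq_integral => w _; rewrite (@CM (s *: X w) (k ^~ w))//.
exact: (measurableT_comp mk (measurable_pair2 w)).
Qed.

(* A coupling of Y with Y + s X. *)
Definition interpolation_coupling s (pi : probability (V * V)%type R) : Prop :=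
  (forall g, measurable_fun [set: V] g -> (forall y, 0 <= g y)%E ->
    \int[pi]_z g z.1 = \int[gam]_y g y)%E /\
  (forall g, measurable_fun [set: V] g -> (forall y, 0 <= g y)%E ->
    \int[pi]_z g z.2 = \int[mu]_w \int[gam]_y g (y + s *: X w)%R)%E.

(** By [tilted_fubini], the second marginal has density [tilt_mass] with respect to [gam]. *)
Lemma interpolation_coupling_snd s pi g : interpolation_coupling s pi ->
  measurable_fun [set: V] g -> (forall y, 0 <= g y)%E ->
  (\int[pi]_z g z.2 = \int[gam]_y ((tilt_mass s y)%:E * g y))%E.
Proof.
move=> [_ h2] mg g0; rewrite h2// -(@tilted_fubini s (fun y _ => g y))//; last first.
  exact: (measurableT_comp mg).
apply: eq_integral => y _; rewrite ge0_integralZr//.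
- by rewrite EFin_tilt_mass.
- by apply/measurable_EFinP; apply: measurable_tilt => //; exact: measurable_scalev.
- by move=> w _; rewrite lee_fin tilt_ge0.
Qed.

(* E[X | Y + s X = y] *)
Definition cond_mean s (y : V) : V :=
  \col_i (tilt_mean s (fun w => X w i ord0) y / tilt_mass s y).

Lemma measurable_cond_mean s : 0 <= s <= 1 -> measurable_fun [set: V] (cond_mean s).
Proof.
move=> s01; apply/measurable_fun_colvecP => i; under eq_fun do rewrite mxE.
apply: measurable_funM; first exact: measurable_tilt_mean.
apply: measurable_invr_ge0; first exact: measurable_tilt_mass.
by move=> y; rewrite ltW// tilt_mass_gt0.
Qed.

(** In the expanded square the cross term averages to [-2 h <D, cond_mean>], which [dot_young]
    splits with weight [k]; the term in [h^2] is bounded through [r]. *)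
Lemma cond_sqr_dist_le s h k y D : 0 <= s <= 1 -> 0 <= h -> 0 < k ->
  \int[mu]_w (tilt t (s *: X w) y / tilt_mass s y * dot (D - h *: X w) (D - h *: X w)) <=
  (1 + h * k) * dot D D + h / k * dot (cond_mean s y) (cond_mean s y) + h ^+ 2 * r ^+ 2.
Proof.
move=> s01 h0 k0; have Z0 := tilt_mass_gt0 y s01.
pose c0 := dot D D + h ^+ 2 * r ^+ 2.
have bl (c : 'I_n -> R) : bounded_mfun (fun w => \sum_i c i * X w i ord0).
  by apply: bounded_mfun_sum => i; apply: bounded_mfunM => //; exact: bounded_mfun_cst.
have bdot : bounded_mfun (fun w => dot (D - h *: X w) (D - h *: X w)).
  apply: bounded_mfun_sum => i; apply: bounded_mfunM;
  under eq_fun do rewrite !mxE;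
    by apply: bounded_mfunD; [exact: bounded_mfun_cst|
      apply: bounded_mfunN; apply: bounded_mfunM => //; exact: bounded_mfun_cst].
have E1 f : bounded_mfun f -> \int[mu]_w (tilt t (s *: X w) y / tilt_mass s y * f w) =
    tilt_mean s f y / tilt_mass s y.
  move=> bf; rewrite /tilt_mean -RintegralZr//; last first.
    by apply: bounded_mfun_integrable; exact: bounded_mfun_tilt.
  by apply: eq_Rintegral => w _; rewrite mulrAC.
rewrite E1//.
apply: (@le_trans _ _ (tilt_mean s (fun w => c0 + \sum_i (- (2 * h * D i ord0)) * X w i ord0) y
   / tilt_mass s y)).
  rewrite ler_wpM2r ?invr_ge0 ?(ltW Z0)//.
  apply: le_Rintegral => //.
  - by apply: bounded_mfun_integrable; exact: bounded_mfun_tilt.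
  - apply/bounded_mfun_integrable/bounded_mfun_tilt/bounded_mfunD => //.
    exact: bounded_mfun_cst.
  move=> w _; rewrite ler_wpM2l ?tilt_ge0//.
  have -> : \sum_i - (2 * h * D i ord0) * X w i ord0 = - (2 * h * dot D (X w)).
    by rewrite /dot mulr_sumr -sumrN; apply: eq_bigr => i _; ring.
  rewrite !dotE (dotC (X w) D) /c0.
  have : h ^+ 2 * dot (X w) (X w) <= h ^+ 2 * r ^+ 2 by rewrite ler_wpM2l ?sqr_ge0.
  lra.
have -> : tilt_mean s (fun w => c0 + \sum_i (- (2 * h * D i ord0)) * X w i ord0) y =
    c0 * tilt_mass s y +
    \sum_i (- (2 * h * D i ord0)) * tilt_mean s (fun w => X w i ord0) y.
  transitivity (\int[mu]_w (c0 * (tilt t (s *: X w) y * 1) +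
     \sum_i (- (2 * h * D i ord0)) * (tilt t (s *: X w) y * X w i ord0))).
    apply: eq_Rintegral => w _; rewrite mulrDr mulr_sumr; congr (_ + _); first by ring.
    by apply: eq_bigr => i _; ring.
  rewrite RintegralD//; last 2 first.
  - apply/bounded_mfun_integrable/bounded_mfunM; first exact: bounded_mfun_cst.
    by apply: bounded_mfun_tilt; exact: bounded_mfun_cst.
  - apply/bounded_mfun_integrable/bounded_mfun_sum => i.
    by apply: bounded_mfunM; [exact: bounded_mfun_cst|exact: bounded_mfun_tilt].
  rewrite RintegralZl//; last first.
    by apply/bounded_mfun_integrable/bounded_mfun_tilt/bounded_mfun_cst.
  rewrite Rintegral_sumB; last first.
    by move=> i; apply: bounded_mfunM; [exact: bounded_mfun_cst|exact: bounded_mfun_tilt].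
  congr (_ + _); apply: eq_bigr => i _.
  by rewrite RintegralZl//; exact/bounded_mfun_integrable/bounded_mfun_tilt.
rewrite mulrDl mulfK ?gt_eqF//.
have -> : (\sum_i - (2 * h * D i ord0) * tilt_mean s (fun w => X w i ord0) y) / tilt_mass s y =
   h * (2 * dot (- D) (cond_mean s y)).
  rewrite /dot !mulr_sumr mulr_suml; apply: eq_bigr => i _; rewrite !mxE; ring.
have := dot_young (- D) (cond_mean s y) k0; rewrite !dotNl !dotNr opprK => hy.
have := ler_wpM2l h0 hy; rewrite /c0; lra.
Qed.

Let c_ge0 s y : 0 <= s <= 1 -> 0 <= (tilt_mass s y)^-1.
Proof. by move=> s01; rewrite invr_ge0 ltW// tilt_mass_gt0. Qed.

(* [h / k] and [h * k] come from splitting the cross term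
   2 h <Y - Y_s, E[X | Y_s]> by Young's inequality with a free weight k. *)
Lemma interpolation_step s h k pi : 0 <= s <= 1 -> 0 <= h -> 0 < k ->
  interpolation_coupling s pi ->
  exists2 pi', interpolation_coupling (s + h) pi' &
  (\int[pi']_z (dot (z.1 - z.2) (z.1 - z.2))%:E <=
   (1 + h * k)%:E * \int[pi]_z (dot (z.1 - z.2) (z.1 - z.2))%:E +
   (h / k)%:E * \int[gam]_y (tilt_mass s y * dot (cond_mean s y) (cond_mean s y))%:E +
   (h ^+ 2 * r ^+ 2)%:E)%E.
Proof.
move=> s01 h0 k0 [hpi1 hpi2].
(* Density, with respect to [mu], of the conditional law given that [Y + s X] is the second point of
   the pair. *)
pose f (p : (V * V) * E) := tilt t (s *: X p.2) p.1.2 / tilt_mass s p.1.2.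
have m12 : measurable_fun [set: (V * V) * E] (fun p => p.1.2).
  exact: (measurableT_comp measurable_snd).
have mf : measurable_fun [set: (V * V) * E] f.
  apply: measurable_funM.
    apply: measurable_tilt => //; apply: measurable_scalev => //.
    exact: (measurableT_comp mX).
  apply: measurable_invr_ge0.
    exact: (measurableT_comp (measurable_tilt_mass s) m12).
  by move=> p; rewrite ltW// tilt_mass_gt0.
have f0 p : 0 <= f p by rewrite mulr_ge0 ?tilt_ge0 ?c_ge0.
have mkap z : measurable_fun [set: E] (fun w => f (z, w)).
  exact: (measurableT_comp mf (measurable_pair1 z)).
have kap1 z : (\int[mu]_w (f (z, w))%:E = 1)%E.
  rewrite /f/=; under eq_integral do rewrite EFinM.
  rewrite ge0_integralZr//.
  - by rewrite -EFin_tilt_mass -EFinM mulfV ?gt_eqF// tilt_mass_gt0.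
  - by apply/measurable_EFinP; apply: measurable_tilt => //; exact: measurable_scalev.
  - by move=> w _; rewrite lee_fin tilt_ge0.
  - by rewrite lee_fin c_ge0.
have f1 : (\int[pi \x mu]_p (f p)%:E = 1)%E.
  rewrite (fubini_tonelli1 (EFin \o f))//=; last exact/measurable_EFinP.
  rewrite /fubini_F; under eq_integral do rewrite /= kap1.
  by rewrite integral_cst// mul1e; exact: probability_setT.
(* The first point stays in place; the second advances by [h] times the resampled [X]. *)
pose phi (p : (V * V) * E) : V * V := (p.1.1, p.1.2 + h *: X p.2).
have mphi : measurable_fun [set: (V * V) * E] phi.
  apply/measurable_fun_pairP; split; rewrite /comp/=.
    exact: (measurableT_comp measurable_fst).
  apply: measurable_addv => //; apply: measurable_scalev => //.
  exact: (measurableT_comp mX).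
have [Q QE] := exists_density_pushforward mf f0 f1 mphi.
have {}QE g : measurable_fun [set: V * V] g -> (forall z, 0 <= g z)%E ->
    (\int[Q]_z g z =
     \int[pi]_z \int[mu]_w ((f (z, w))%:E * g (z.1, z.2 + h *: X w)%R))%E.
  move=> mg g0; rewrite QE//.
  rewrite (fubini_tonelli1 (fun p => (f p)%:E * g (phi p))%E)//.
  - apply: emeasurable_funM; first exact/measurable_EFinP.
    exact: (measurableT_comp mg).
  - by move=> p; rewrite mule_ge0// lee_fin.
exists Q; first split.
- move=> g mg g0; rewrite (QE (fun z => g z.1))//; last exact: (measurableT_comp mg).
  rewrite -hpi1//; apply: eq_integral => z _ /=.
  rewrite ge0_integralZr//; first by rewrite kap1 mul1e.
  + by apply/measurable_EFinP; exact: mkap.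
  + by move=> w _; rewrite lee_fin.
- move=> g mg g0; rewrite (QE (fun z => g z.2))//; last exact: (measurableT_comp mg).
  pose G y := (\int[mu]_w ((tilt t (s *: X w) y / tilt_mass s y)%:E * g (y + h *: X w)%R))%E.
  have mgy : measurable_fun [set: V * E] (fun p => g (p.1 + h *: X p.2)).
    apply: (measurableT_comp mg); apply: measurable_addv => //.
    by apply: measurable_scalev => //; exact: (measurableT_comp mX).
  have mkap' : measurable_fun [set: V * E]
      (fun p => (tilt t (s *: X p.2) p.1 / tilt_mass s p.1)%:E).
    apply/measurable_EFinP; apply: measurable_funM; first exact: measurable_weight.
    apply: measurable_invr_ge0.
      exact: (measurableT_comp (measurable_tilt_mass s)).
    by move=> p; rewrite ltW// tilt_mass_gt0.
  have mG : measurable_fun [set: V] G.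
    apply: (measurable_fun_fubini_tonelli_F (m2 := mu)
      (fun p => (tilt t (s *: X p.2) p.1 / tilt_mass s p.1)%:E * g (p.1 + h *: X p.2)%R)%E).
      exact: emeasurable_funM.
    by move=> p; rewrite mule_ge0// lee_fin mulr_ge0 ?tilt_ge0 ?c_ge0.
  have G0 y : (0 <= G y)%E.
    apply: integral_ge0 => w _; rewrite mule_ge0// lee_fin.
    by rewrite mulr_ge0 ?tilt_ge0 ?c_ge0.
  transitivity (\int[pi]_z G z.2)%E; first by [].
  (* The density [tilt_mass] of the second marginal cancels the normalisation of the kernel. The
     remaining tilt becomes a shift by [s X], with the same [X] as in [h X], so the shifts add up to
     [(s + h) X]. *)
  rewrite (interpolation_coupling_snd (conj hpi1 hpi2))//.
  transitivity (\int[gam]_y \int[mu]_w ((tilt t (s *: X w) y)%:E * g (y + h *: X w)%R))%E.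
    apply: eq_integral => y _.
    rewrite /G -ge0_integralZl//.
    + apply: eq_integral => w _; rewrite muleA -EFinM; congr (_%:E * _)%E.
      by rewrite mulrC divfK// gt_eqF// tilt_mass_gt0.
    + apply: emeasurable_funM.
        exact: (measurableT_comp mkap' (measurable_pair1 y)).
      exact: (measurableT_comp mgy (measurable_pair1 y)).
    + move=> w _; rewrite mule_ge0// lee_fin.
      by rewrite mulr_ge0 ?tilt_ge0 ?c_ge0.
    + by rewrite lee_fin ltW// tilt_mass_gt0.
  have tf := @tilted_fubini s (fun y w => g (y + h *: X w)) mgy (fun y w => g0 _).
  apply: (eq_trans tf).
  apply: eq_integral => w _; apply: eq_integral => y _.
  by rewrite -addrA -scalerDl.
have mD : measurable_fun [set: V * V] (fun z => (dot (z.1 - z.2) (z.1 - z.2))%:E).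
  apply/measurable_EFinP; apply: measurable_dot;
    by apply: measurable_addv => //; exact: measurable_oppv.
rewrite (QE (fun z => (dot (z.1 - z.2) (z.1 - z.2))%:E))//; last first.
  by move=> z; rewrite lee_fin dot_ge0.
have mB : measurable_fun [set: V] (fun y => (dot (cond_mean s y) (cond_mean s y))%:E).
  by apply/measurable_EFinP; apply: measurable_dot; exact: measurable_cond_mean.
have mB2 : measurable_fun [set: V * V] (fun z => (dot (cond_mean s z.2) (cond_mean s z.2))%:E).
  exact: (measurableT_comp mB).
have B0 y : (0 <= (dot (cond_mean s y) (cond_mean s y))%:E)%E by rewrite lee_fin dot_ge0.
have D0 z : (0 <= (dot (z.1 - z.2) (z.1 - z.2) : R)%:E)%E by rewrite lee_fin dot_ge0.
have hk0 : 0 <= h / k by rewrite divr_ge0// ltW.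
have hk1 : 0 <= 1 + h * k by rewrite addr_ge0// mulr_ge0// ltW.
(* Pointwise in the pair this is [cond_sqr_dist_le], with [D] the displacement reached so far. *)
apply: (@le_trans _ _ (\int[pi]_z ((1 + h * k)%:E * (dot (z.1 - z.2) (z.1 - z.2))%:E +
  (h / k)%:E * (dot (cond_mean s z.2) (cond_mean s z.2))%:E + (h ^+ 2 * r ^+ 2)%:E))%E).
  apply: ge0_le_integral => //.
  - move=> z _; apply: integral_ge0 => w _.
    by rewrite -EFinM lee_fin mulr_ge0// dot_ge0.
  - apply: (measurable_fun_fubini_tonelli_F (m2 := mu)
      (fun p => (f p)%:E * (dot ((phi p).1 - (phi p).2) ((phi p).1 - (phi p).2))%:E)%E).
      apply: emeasurable_funM; first exact/measurable_EFinP.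
      exact: (measurableT_comp mD mphi).
    by move=> p; rewrite mule_ge0// lee_fin// dot_ge0.
  - apply: emeasurable_funD => //; apply: emeasurable_funD; exact: measurable_funeM.
  - move=> z _; rewrite -!EFinM -!EFinD.
    have bdot : bounded_mfun (fun w => dot (z.1 - z.2 - h *: X w) (z.1 - z.2 - h *: X w)).
      apply: bounded_mfun_sum => i; apply: bounded_mfunM;
      under eq_fun do rewrite 2!mxE;
        by apply: bounded_mfunD; [exact: bounded_mfun_cst|
          under eq_fun do rewrite 2!mxE; apply: bounded_mfunN; apply: bounded_mfunM => //; exact: bounded_mfun_cst].
    have bker : bounded_mfun (fun w => tilt t (s *: X w) z.2 / tilt_mass s z.2).
      by apply: bounded_mfunM; [exact: bweight|exact: bounded_mfun_cst].
    have := cond_sqr_dist_le z.2 (z.1 - z.2) s01 h0 k0.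
    rewrite -lee_fin EFin_Rintegral; last exact: bounded_mfunM.
    apply: le_trans; rewrite le_eqVlt; apply/orP; left; apply/eqP.
    apply: eq_integral => w _; rewrite -EFinM; congr (_ * dot _ _)%:E;
      by rewrite /= opprD addrA.
rewrite ge0_integralD//; last 3 first.
- by move=> z _; rewrite adde_ge0// mule_ge0// lee_fin.
- by apply: emeasurable_funD; exact: measurable_funeM.
- by move=> z _; rewrite lee_fin mulr_ge0// sqr_ge0.
rewrite ge0_integralD//; last 4 first.
- by move=> z _; rewrite mule_ge0// lee_fin.
- exact: measurable_funeM.
- by move=> z _; rewrite mule_ge0// lee_fin.
- exact: measurable_funeM.
rewrite !ge0_integralZl//.
rewrite (interpolation_coupling_snd (g := fun y => (dot (cond_mean s y) (cond_mean s y))%:E)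
  (conj hpi1 hpi2))//.
rewrite [X in (_ + _ + X)%E](_ : _ = (h ^+ 2 * r ^+ 2)%:E); last first.
  by rewrite integral_cst// -[RHS]mule1; congr (_ * _)%E; exact: probability_setT.
by under [X in (_ <= _ + _ * X + _)%E]eq_integral do rewrite EFinM.
Qed.

End step.

(** * Second moment of the conditional mean, through two independent copies of X *)

Section product_means.
Context d (E : measurableType d) (R : realType) (mu : probability E R).

Lemma Rintegral_prod (f g : E -> R) : bounded_mfun f -> bounded_mfun g ->
  \int[(mu \x mu)%E]_p (f p.1 * g p.2) = \int[mu]_w f w * \int[mu]_w g w.
Proof.
move=> bf bg.
have bfg : bounded_mfun (fun p : E * E => f p.1 * g p.2).
  apply: bounded_mfunM.
    have [mf [M fM]] := bf; split; first exact: (measurableT_comp mf).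
    by exists M => p; exact: fM.
  have [mg [M gM]] := bg; split; first exact: (measurableT_comp mg).
  by exists M => p; exact: gM.
have ifg := bounded_mfun_integrable (mu \x mu)%E bfg.
transitivity (fine (\int[mu]_w \int[mu]_w' (f w * g w')%:E)%E).
  by congr fine; apply/esym; exact: (integral12_prod_meas1 ifg).
rewrite -RintegralZr//; last exact: bounded_mfun_integrable.
congr fine; apply: eq_integral => w _ /=.
by rewrite EFinM EFin_Rintegral// -integralZl//; exact: bounded_mfun_integrable.
Qed.

End product_means.

Section conditional_mean_bound.
Context (R : realType) (n : nat) (t : R) (gam : probability 'cV[R]_n R).
Context d (E : measurableType d) (mu : probability E R) (X : E -> 'cV[R]_n) (r : R).
Notation V := 'cV[R]_n.
Hypotheses (t0 : 0 < t) (CM : forall a, cameron_martin t gam a).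
Hypotheses (mX : measurable_fun [set: E] X) (r0 : 0 < r).
Hypothesis Xr : forall w, dot (X w) (X w) <= r ^+ 2.
Hypothesis X0 : forall i, \int[mu]_w (X w i ord0) = 0.
Hypothesis rt : 2 * r ^+ 2 <= t.

Let bX i : bounded_mfun (fun w => X w i ord0).
Proof.
split; first exact: measurable_fun_coord.
by exists r => w; apply: abs_coord_le => //; exact: ltW.
Qed.

(** Shifting the argument by [a] multiplies [tilt t b] by [exp (<a, b> / t)], and a tilt has
    integral one. *)
Lemma gaussian_tilt_tilt (a b : V) :
  (\int[gam]_y (tilt t a y * tilt t b y)%:E = (expR (dot a b / t))%:E)%E.
Proof.
have mt c : measurable_fun [set: V] (fun y => (tilt t c y)%:E).
  by apply/measurable_EFinP; exact: measurable_tilt.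
under eq_integral do rewrite EFinM.
rewrite CM//; last by move=> y; rewrite lee_fin tilt_ge0.
have E1 y : ((tilt t b (y + a))%:E = (expR (dot a b / t))%:E * (tilt t b y)%:E)%E.
  rewrite -EFinM /tilt -expRD -mulrDl.
  suff -> : dot b (y + a) - 2^-1 * dot b b = dot a b + (dot b y - 2^-1 * dot b b) by [].
  rewrite !dotE (dotC b a); lra.
under eq_integral do rewrite E1.
rewrite ge0_integralZl//.
- rewrite -[RHS]mule1; congr (_ * _)%E.
  transitivity (\int[gam]_y ((tilt t b y)%:E * cst 1%E y))%E.
    by apply: eq_integral => y _; rewrite mule1.
  by rewrite CM// integral_cst// mul1e; exact: probability_setT.
- by move=> y _; rewrite lee_fin tilt_ge0.
Qed.

Let u (p : E * E) := dot (X p.1) (X p.2).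

Let u_le p : `|u p| <= r ^+ 2.
Proof.
rewrite -(ler_pXn2r (n:=2))// ?nnegrE ?sqr_ge0// real_normK ?num_real//.
rewrite (le_trans (dot_cauchy_schwarz _ _))//.
by rewrite [leRHS]expr2 ler_pM// ?dot_ge0.
Qed.

Let bX1 i : bounded_mfun (fun p : E * E => X p.1 i ord0).
Proof.
have [mf [M fM]] := bX i; split; first exact: (measurableT_comp mf).
by exists M => p; exact: fM.
Qed.

Let bX2 i : bounded_mfun (fun p : E * E => X p.2 i ord0).
Proof.
have [mf [M fM]] := bX i; split; first exact: (measurableT_comp mf).
by exists M => p; exact: fM.
Qed.

Let bu : bounded_mfun u.
Proof. by apply: bounded_mfun_sum => i; exact: bounded_mfunM. Qed.

Let bexp c : bounded_mfun (fun p => expR (c * u p)).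
Proof.
split; first by apply: measurableT_comp => //; apply: measurable_funM => //; exact: (proj1 bu).
exists (expR (`|c| * r ^+ 2)) => p; rewrite ger0_norm ?expR_ge0// ler_expR.
by rewrite (le_trans (ler_norm _))// normrM ler_wpM2l.
Qed.

Lemma Rintegral_dot_prod : \int[(mu \x mu)%E]_p dot (X p.1) (X p.2) = 0.
Proof.
rewrite (Rintegral_sumB (mu \x mu)%E); last by move=> i; exact: bounded_mfunM.
by rewrite big1// => i _; rewrite (Rintegral_prod mu (bX i) (bX i)) X0 mul0r.
Qed.

(** The square of [<X1, X2>] is a sum over [i, j] of a function of [X1] times the same function of
    [X2], so independence yields the squared Frobenius norm of the second moment matrix. *)
Lemma Rintegral_dot_sqr_prod : \int[(mu \x mu)%E]_p dot (X p.1) (X p.2) ^+ 2 =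
  \sum_i \sum_j (\int[mu]_w (X w i ord0 * X w j ord0)) ^+ 2.
Proof.
transitivity (\int[(mu \x mu)%E]_p (\sum_i \sum_j
    (X p.1 i ord0 * X p.1 j ord0) * (X p.2 i ord0 * X p.2 j ord0))).
  apply: eq_Rintegral => p _; rewrite expr2 /dot mulr_suml; apply: eq_bigr => i _.
  by rewrite mulr_sumr; apply: eq_bigr => j _; ring.
rewrite (Rintegral_sumB (mu \x mu)%E); last first.
  move=> i; apply: bounded_mfun_sum => j.
  by apply: bounded_mfunM; exact: bounded_mfunM.
apply: eq_bigr => i _.
rewrite (Rintegral_sumB (mu \x mu)%E); last first.
  by move=> j; apply: bounded_mfunM; exact: bounded_mfunM.
apply: eq_bigr => j _; rewrite expr2.
by apply: (Rintegral_prod mu (f := fun w => X w i ord0 * X w j ord0)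
  (g := fun w => X w i ord0 * X w j ord0)); exact: bounded_mfunM.
Qed.

(** Put [z = c x]. For [x < 0] the bound [exp z >= 1 + z] suffices; for [x >= 0] one has
    [exp z <= 1 / (1 - z) <= 1 + z + 2 z^2] as long as [z <= 1/2]. The cubic term is the source of
    the error in [t^-2]. *)
Lemma mul_expR_le (c x : R) : 0 <= c -> c * `|x| <= 2^-1 ->
  x * expR (c * x) <= x + c * x ^+ 2 + 2 * c ^+ 2 * `|x| ^+ 3.
Proof.
move=> c0; have [x0|x0] := leP 0 x; last first.
  move=> _; have h := expR_ge1Dx (c * x).
  have : x * expR (c * x) <= x * (1 + c * x) by rewrite ler_wnM2l// ltW.
  have : 0 <= 2 * c ^+ 2 * `|x| ^+ 3 by rewrite !mulr_ge0// ?sqr_ge0// exprn_ge0.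
  lra.
rewrite ger0_norm// => cx.
have cx0 : 0 <= c * x by exact: mulr_ge0.
have h : expR (c * x) <= 1 + c * x + 2 * (c * x) ^+ 2.
  have h1 := expR_ge1Dx (- (c * x)); rewrite expRN in h1.
  have e0 := expR_gt0 (c * x).
  have : (1 - c * x) * expR (c * x) <= 1.
    by rewrite -[leRHS](mulVf (lt0r_neq0 e0)) ler_wpM2r// ltW.
  set e := expR _ in e0 *; set z := c * x in cx cx0 *.
  move=> h2; rewrite -subr_ge0.
  have z1 : 0 < 1 - z by lra.
  rewrite -(pmulr_rge0 _ z1).
  have -> : (1 - z) * (1 + z + 2 * z ^+ 2 - e) = z ^+ 2 * (1 - 2 * z) + (1 - (1 - z) * e) by ring.
  by rewrite addr_ge0 ?mulr_ge0 ?sqr_ge0// ?subr_ge0//; lra.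
have := ler_wpM2l x0 h.
by rewrite [X in _ <= X -> _](_ : _ = x + c * x ^+ 2 + 2 * c ^+ 2 * x ^+ 3)//; ring.
Qed.

Let tilt2 s y (p : E * E) := tilt t (s *: X p.1) y * tilt t (s *: X p.2) y.

Let btilt2 s y : bounded_mfun (tilt2 s y).
Proof.
have b1 : bounded_mfun (fun w => tilt t (s *: X w) y * 1).
  by apply: bounded_mfun_tilt => //; exact: bounded_mfun_cst.
have [m1 [M hM]] := b1.
apply: bounded_mfunM.
  split; first by apply: measurable_tilt => //; apply: measurable_scalev => //; exact: (measurableT_comp mX).
  by exists M => p; have := hM p.1; rewrite mulr1.
split; first by apply: measurable_tilt => //; apply: measurable_scalev => //; exact: (measurableT_comp mX).
by exists M => p; have := hM p.2; rewrite mulr1.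
Qed.

(** A square of averages over [X] is an average over two copies, for which the Gaussian integral of
    the product of tilts is explicit. Nonnegativity of [q] is for Tonelli. *)
Lemma gaussian_integral_tilt2 s (q : E * E -> R) : bounded_mfun q -> (forall p, 0 <= q p) ->
  (\int[gam]_y (\int[(mu \x mu)%E]_p
      (tilt t (s *: X p.1) y * tilt t (s *: X p.2) y * q p)%R)%:E =
   (\int[(mu \x mu)%E]_p (expR (s ^+ 2 / t * dot (X p.1) (X p.2)) * q p)%R)%:E)%E.
Proof.
move=> bq q0.
transitivity (\int[gam]_y \int[mu \x mu]_p (tilt2 s y p * q p)%:E)%E.
  apply: eq_integral => y _.
  by apply: (EFin_Rintegral (mu \x mu)%E); apply: bounded_mfunM => //; exact: btilt2.
have mq2 : measurable_fun [set: V * (E * E)] (fun z => (tilt2 s z.1 z.2 * q z.2)%:E).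
  apply/measurable_EFinP; apply: measurable_funM.
    apply: measurable_funM.
      apply: measurable_tilt => //; apply: measurable_scalev => //.
      by apply: (measurableT_comp mX); exact: (measurableT_comp measurable_fst).
    apply: measurable_tilt => //; apply: measurable_scalev => //.
    by apply: (measurableT_comp mX); exact: (measurableT_comp measurable_snd).
  exact: (measurableT_comp (proj1 bq)).
have q20 (z : V * (E * E)) : (0 <= (tilt2 s z.1 z.2 * q z.2)%:E)%E.
  by rewrite lee_fin !mulr_ge0 ?tilt_ge0.
pose mu2 : probability (E * E)%type R := (mu \x mu)%E.
apply: (eq_trans (fubini_tonelli (m1 := gam) (m2 := mu2) _ mq2 q20)).
rewrite (EFin_Rintegral (mu \x mu)%E); last by apply: bounded_mfunM => //; exact: bexp.
apply: eq_integral => p _.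
transitivity (\int[gam]_y ((tilt2 s y p)%:E * (q p)%:E))%E.
  by apply: eq_integral => y _; rewrite -EFinM.
rewrite ge0_integralZr//.
- rewrite gaussian_tilt_tilt EFinM; congr (_%:E * _)%E; congr expR.
  by rewrite !dotE; ring.
- apply/measurable_EFinP; by apply: measurable_funM; exact: measurable_tilt.
- by move=> y _; rewrite lee_fin mulr_ge0 ?tilt_ge0.
- by rewrite lee_fin.
Qed.

(** The integrand is the squared norm [S] of the unnormalised mean divided by [tilt_mass], and
    [tilt_mass_ge] removes the quotient. The integral of [S] is an average over two copies, whose
    first order term vanishes by centring. *)
Lemma cond_mean_sqr_le s : 0 <= s <= 1 ->
  (\int[gam]_y (tilt_mass t mu X s y *
      dot (cond_mean t mu X s y) (cond_mean t mu X s y))%:E <=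
   ((s ^+ 2 / t * (\sum_i \sum_j (\int[mu]_w (X w i ord0 * X w j ord0)) ^+ 2) +
     2 * r ^+ 6 / t ^+ 2) / (1 - r ^+ 2 / (2 * t)))%:E)%E.
Proof.
move=> s01; have /andP[s0 s1] := s01.
set F2 := \sum_i \sum_j _; set c0 := 1 - _.
have c00 : 0 < c0.
  have t2 : 0 < 2 * t by move: t0; lra.
  rewrite subr_gt0 ltr_pdivrMr// mul1r.
  by move: (sqr_ge0 r) t0 rt; lra.
pose c := s ^+ 2 / t.
have s2 : s ^+ 2 <= 1 by rewrite expr_le1.
have c_ge0 : 0 <= c by rewrite mulr_ge0 ?sqr_ge0// invr_ge0 ltW.
have cV : c <= t^-1 by rewrite -[leRHS]mul1r ler_wpM2r// invr_ge0 ltW.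
have cr : c * r ^+ 2 <= 2^-1.
  apply: (@le_trans _ _ (t^-1 * r ^+ 2)); first by rewrite ler_wpM2r// sqr_ge0.
  by rewrite ler_pdivrMl//; move: rt; lra.
pose U i y := tilt_mean t mu X s (fun w => X w i ord0) y.
pose S y := \sum_i U i y ^+ 2.
pose Z y := tilt_mass t mu X s y.
have Z0 y : 0 < Z y by exact: (tilt_mass_gt0 t0 mX r0 Xr X0 rt).
have mU i : measurable_fun [set: V] (U i) by exact: measurable_tilt_mean.
have mS : measurable_fun [set: V] S.
  by apply: measurable_sum => i; exact: measurable_funX.
have mZ : measurable_fun [set: V] Z by exact: measurable_tilt_mass.
have S0 y : 0 <= S y by apply: sumr_ge0 => i _; exact: sqr_ge0.
have bw y : bounded_mfun (fun w => tilt t (s *: X w) y * 1).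
  by apply: bounded_mfun_tilt => //; exact: bounded_mfun_cst.
have bwX i y : bounded_mfun (fun w => tilt t (s *: X w) y * X w i ord0).
  exact: bounded_mfun_tilt.
have ZE y : Z y ^+ 2 = \int[(mu \x mu)%E]_p (tilt2 s y p * 1).
  rewrite expr2 /Z /tilt_mass /tilt_mean -(Rintegral_prod mu (bw y) (bw y)).
  by apply: eq_Rintegral => p _; rewrite /tilt2; ring.
(* [u] may be negative: adding [r ^+ 2] makes the integrand nonnegative, as
   [gaussian_integral_tilt2] requires. The surplus [r ^+ 2 * Z y ^+ 2] is cancelled in [IS]. *)
have SE y : S y + r ^+ 2 * Z y ^+ 2 = \int[(mu \x mu)%E]_p (tilt2 s y p * (u p + r ^+ 2)).
  transitivity (\int[(mu \x mu)%E]_p (\sum_i ((tilt t (s *: X p.1) y * X p.1 i ord0) *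
      (tilt t (s *: X p.2) y * X p.2 i ord0)) + r ^+ 2 * (tilt2 s y p * 1))).
    rewrite (@RintegralD _ _ _ (mu \x mu)%E)//; last 2 first.
    - apply: (bounded_mfun_integrable (mu \x mu)%E); apply: bounded_mfun_sum => i.
      have -> : (fun p : E * E => tilt t (s *: X p.1) y * X p.1 i ord0 *
          (tilt t (s *: X p.2) y * X p.2 i ord0)) =
          (fun p => tilt2 s y p * (X p.1 i ord0 * X p.2 i ord0)).
        by apply/funext => p; rewrite /tilt2; ring.
      by apply: bounded_mfunM => //; exact: bounded_mfunM.
    - apply: (bounded_mfun_integrable (mu \x mu)%E); apply: bounded_mfunM; first exact: bounded_mfun_cst.
      by apply: bounded_mfunM => //; exact: bounded_mfun_cst.
    rewrite (Rintegral_sumB (mu \x mu)%E); last first.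
      move=> i; have -> : (fun p : E * E => tilt t (s *: X p.1) y * X p.1 i ord0 *
          (tilt t (s *: X p.2) y * X p.2 i ord0)) =
          (fun p => tilt2 s y p * (X p.1 i ord0 * X p.2 i ord0)).
        by apply/funext => p; rewrite /tilt2; ring.
      by apply: bounded_mfunM => //; exact: bounded_mfunM.
    congr (_ + _).
      by apply: eq_bigr => i _; rewrite (Rintegral_prod mu (bwX i y) (bwX i y)) -expr2.
    rewrite (@RintegralZl _ _ _ (mu \x mu)%E)// ?ZE//.
    apply: (bounded_mfun_integrable (mu \x mu)%E).
    by apply: bounded_mfunM => //; exact: bounded_mfun_cst.
  apply: eq_Rintegral => p _; rewrite mulrDr mulr1 [r ^+ 2 * _]mulrC; congr (_ + _).
  by rewrite /u /dot mulr_sumr; apply: eq_bigr => i _; rewrite /tilt2; ring.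
pose K := \int[(mu \x mu)%E]_p (expR (c * u p) * 1).
pose A := \int[(mu \x mu)%E]_p (expR (c * u p) * (u p + r ^+ 2)).
have bu2 : bounded_mfun (fun p => u p + r ^+ 2).
  by apply: bounded_mfunD => //; exact: bounded_mfun_cst.
have u20 p : 0 <= u p + r ^+ 2 by have := u_le p; rewrite ler_norml; lra.
have IA : (\int[gam]_y (S y + r ^+ 2 * Z y ^+ 2)%:E = A%:E)%E.
  rewrite /A -(gaussian_integral_tilt2 s bu2 u20).
  by apply: eq_integral => y _; rewrite SE.
have IK : (\int[gam]_y (Z y ^+ 2)%:E = K%:E)%E.
  rewrite /K -(gaussian_integral_tilt2 s (@bounded_mfun_cst _ (E * E)%type R 1) (fun=> ler01)).
  by apply: eq_integral => y _; rewrite ZE.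
(* [mul_expR_le] with [c <= 1 / t] and [|u| <= r^2]; the mean of [u] is zero and that of [u ^+ 2] is
   [F2]. *)
have AK : A <= c * F2 + 2 * r ^+ 6 / t ^+ 2 + r ^+ 2 * K.
  have bu' : bounded_mfun (fun p => u p + c * u p ^+ 2).
    apply: bounded_mfunD => //; apply: bounded_mfunM; first exact: bounded_mfun_cst.
    by under eq_fun do rewrite expr2; exact: bounded_mfunM.
  have bK : bounded_mfun (fun p => expR (c * u p) * 1).
    by apply: bounded_mfunM; [exact: bexp|exact: bounded_mfun_cst].
  pose b0 := 2 * r ^+ 6 / t ^+ 2.
  apply: (@le_trans _ _ (\int[(mu \x mu)%E]_p
     (u p + c * u p ^+ 2 + b0 + r ^+ 2 * (expR (c * u p) * 1)))).
    apply: (@le_Rintegral _ _ _ (mu \x mu)%E) => //.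
    - apply: (bounded_mfun_integrable (mu \x mu)%E); apply: bounded_mfunM => //; exact: bexp.
    - apply: (bounded_mfun_integrable (mu \x mu)%E); apply: bounded_mfunD.
        by apply: bounded_mfunD => //; exact: bounded_mfun_cst.
      by apply: bounded_mfunM => //; exact: bounded_mfun_cst.
    move=> p _; rewrite mulrDr mulr1 [_ * r ^+ 2]mulrC lerD2r mulrC.
    apply: (le_trans (mul_expR_le c_ge0 _)).
      by rewrite (le_trans _ cr)// ler_wpM2l.
    have -> : b0 = 2 * t^-1 ^+ 2 * (r ^+ 2) ^+ 3 by rewrite /b0; field; rewrite gt_eqF.
    rewrite lerD2l ler_pM ?exprn_ge0//.
    - by rewrite mulr_ge0// sqr_ge0.
    - by rewrite ler_wpM2l// lerXn2r// nnegrE// invr_ge0 ltW.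
    - by rewrite lerXn2r// nnegrE ?sqr_ge0.
  rewrite (@RintegralD _ _ _ (mu \x mu)%E)//; last 2 first.
  - apply: (bounded_mfun_integrable (mu \x mu)%E).
    by apply: bounded_mfunD => //; exact: bounded_mfun_cst.
  - apply: (bounded_mfun_integrable (mu \x mu)%E).
    by apply: bounded_mfunM => //; exact: bounded_mfun_cst.
  rewrite (@RintegralZl _ _ _ (mu \x mu)%E)//; last exact: (bounded_mfun_integrable (mu \x mu)%E).
  rewrite lerD2r (@RintegralD _ _ _ (mu \x mu)%E)//; last 2 first.
  - exact: (bounded_mfun_integrable (mu \x mu)%E).
  - by apply: (bounded_mfun_integrable (mu \x mu)%E); exact: bounded_mfun_cst.
  rewrite (Rintegral_cstP (mu \x mu)%E) lerD2r.
  rewrite (@RintegralD _ _ _ (mu \x mu)%E)//; last 2 first.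
  - exact: (bounded_mfun_integrable (mu \x mu)%E).
  - apply: (bounded_mfun_integrable (mu \x mu)%E); apply: bounded_mfunM; first exact: bounded_mfun_cst.
    by under eq_fun do rewrite expr2; exact: bounded_mfunM.
  rewrite Rintegral_dot_prod add0r (@RintegralZl _ _ _ (mu \x mu)%E)//; last first.
    apply: (bounded_mfun_integrable (mu \x mu)%E).
    by under eq_fun do rewrite /= expr2; exact: bounded_mfunM.
  by rewrite Rintegral_dot_sqr_prod.
have IS : (\int[gam]_y (S y)%:E <= (c * F2 + 2 * r ^+ 6 / t ^+ 2)%:E)%E.
  rewrite -(@leeD2rE _ (r ^+ 2 * K)%:E)// -EFinD.
  apply: (@le_trans _ _ A%:E); last by rewrite lee_fin.
  rewrite -IA EFinM -IK -ge0_integralZl//; last 3 first.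
  - by apply/measurable_EFinP; exact: measurable_funX.
  - by move=> y _; rewrite lee_fin sqr_ge0.
  - by rewrite lee_fin sqr_ge0.
  rewrite -ge0_integralD//; last 4 first.
  - by move=> y _; rewrite lee_fin.
  - exact/measurable_EFinP.
  - by move=> y _; rewrite lee_fin mulr_ge0 ?sqr_ge0.
  - by apply/measurable_EFinP; apply: measurable_funM => //; exact: measurable_funX.
apply: (@le_trans _ _ (\int[gam]_y ((c0^-1)%:E * (S y)%:E))%E).
  apply: ge0_le_integral => //.
  - by move=> y _; rewrite lee_fin mulr_ge0 ?dot_ge0// ltW.
  - apply/measurable_EFinP; apply: measurable_funM => //.
    by apply: measurable_dot; exact: (measurable_cond_mean t0 mX r0 Xr X0 rt).
  - by apply: measurable_funeM; exact/measurable_EFinP.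
  - move=> y _; rewrite -EFinM lee_fin.
    have -> : tilt_mass t mu X s y * dot (cond_mean t mu X s y) (cond_mean t mu X s y) =
        (Z y)^-1 * S y.
      rewrite /dot /S !mulr_sumr; apply: eq_bigr => i _; rewrite !mxE -/(Z y) -/(U i y).
      by field; rewrite gt_eqF.
    rewrite ler_wpM2r// lef_pV2 ?posrE//.
    exact: (tilt_mass_ge t0 mX r0 Xr X0 y s01).
rewrite ge0_integralZl//; last 3 first.
- exact/measurable_EFinP.
- by move=> y _; rewrite lee_fin.
- by rewrite lee_fin invr_ge0 ltW.
by rewrite mulrC EFinM lee_pmul2l// lte_fin invr_gt0.
Qed.

End conditional_mean_bound.

(** * Iteration of the interpolation step from s = 0 to s = 1 *)

Section chain.
Context (R : realType) (n : nat) (t : R) (gam : probability 'cV[R]_n R).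
Context d (E : measurableType d) (mu : probability E R) (X : E -> 'cV[R]_n) (r : R).
Notation V := 'cV[R]_n.
Hypotheses (t0 : 0 < t) (CM : forall a, cameron_martin t gam a).
Hypotheses (mX : measurable_fun [set: E] X) (r0 : 0 < r).
Hypothesis Xr : forall w, dot (X w) (X w) <= r ^+ 2.
Hypothesis X0 : forall i, \int[mu]_w (X w i ord0) = 0.
Hypothesis rt : 2 * r ^+ 2 <= t.

Let F := Num.sqrt (\sum_i \sum_j (\int[mu]_w (X w i ord0 * X w j ord0)) ^+ 2).
Let c0 := 1 - r ^+ 2 / (2 * t).

Let c00 : 0 < c0.
Proof.
have t2 : 0 < 2 * t by move: t0; lra.
rewrite subr_gt0 ltr_pdivrMr// mul1r.
by move: (sqr_ge0 r) t0 rt; lra.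
Qed.

(** Its square dominates the bound of [cond_mean_sqr_le]. The summand in [r ^+ 3] absorbs the error
    and keeps [b s] positive even when [F = 0], so that [b s] may enter a Young weight. *)
Let b s := (s * F + 2 * r ^+ 3 / Num.sqrt t) / Num.sqrt (t * c0).

Let b_gt0 s : 0 <= s -> 0 < b s.
Proof.
move=> s0; rewrite divr_gt0 ?sqrtr_gt0 ?mulr_gt0//.
by rewrite ltr_wpDl ?mulr_ge0 ?sqrtr_ge0// divr_gt0 ?sqrtr_gt0// mulr_gt0// exprn_gt0.
Qed.

Let cond_mean_le s : 0 <= s <= 1 ->
  (\int[gam]_y (tilt_mass t mu X s y *
      dot (cond_mean t mu X s y) (cond_mean t mu X s y))%:E <= (b s ^+ 2)%:E)%E.
Proof.
move=> s01; have /andP[s0 s1] := s01.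
apply: (le_trans (cond_mean_sqr_le t0 CM mX r0 Xr X0 rt s01)).
rewrite lee_fin /b expr_div_n sqr_sqrtr ?mulr_ge0 ?(ltW t0) ?(ltW c00)//.
rewrite [leRHS](_ : _ = (s * F + 2 * r ^+ 3 / Num.sqrt t) ^+ 2 / t / c0); last first.
  by rewrite invfM mulrA.
rewrite ler_wpM2r ?invr_ge0 ?(ltW c00)//.
have F2 : \sum_i \sum_j (\int[mu]_w (X w i ord0 * X w j ord0)) ^+ 2 = F ^+ 2.
  rewrite sqr_sqrtr//; apply: sumr_ge0 => i _; apply: sumr_ge0 => j _; exact: sqr_ge0.
rewrite F2.
set q := Num.sqrt t.
have q0 : 0 < q by rewrite sqrtr_gt0.
have -> : t = q ^+ 2 by rewrite sqr_sqrtr// ltW.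
rewrite -subr_ge0.
have -> : (s * F + 2 * r ^+ 3 / q) ^+ 2 / q ^+ 2 -
    (s ^+ 2 / q ^+ 2 * F ^+ 2 + 2 * r ^+ 6 / (q ^+ 2) ^+ 2) =
    (4 * (s * F * r ^+ 3) / q + 2 * r ^+ 6 / q ^+ 2) / q ^+ 2.
  by field; rewrite gt_eqF.
rewrite divr_ge0 ?sqr_ge0// addr_ge0//.
  by rewrite divr_ge0 ?(ltW q0)// !mulr_ge0 ?sqrtr_ge0 ?exprn_ge0// ?(ltW r0).
by rewrite divr_ge0 ?sqr_ge0// mulr_ge0// exprn_ge0// ltW.
Qed.

Let diagonal_coupling : exists2 pi, interpolation_coupling gam mu X 0 pi &
  (\int[pi]_z (dot (z.1 - z.2) (z.1 - z.2))%:E <= 0)%E.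
Proof.
have mdiag : measurable_fun [set: V] (fun y : V => (y, y)) by exact: measurable_fun_pair.
have mD : measurable_fun [set: V * V] (fun z => (dot (z.1 - z.2) (z.1 - z.2))%:E).
  apply/measurable_EFinP; apply: measurable_dot;
    by apply: measurable_addv => //; exact: measurable_oppv.
have one : (\int[gam]_y (1:R)%:E = 1)%E.
  by rewrite integral_cst// mul1e; exact: probability_setT.
have [Q QE] := exists_density_pushforward (measurable_cst _) (fun=> ler01) one mdiag.
exists Q.
  split=> g mg g0.
    rewrite (QE (fun z => g z.1))//; last exact: (measurableT_comp mg).
    by apply: eq_integral => y _; rewrite mul1e.
  rewrite (QE (fun z => g z.2))//; last exact: (measurableT_comp mg).
  under eq_integral do rewrite mul1e.
  under [RHS]eq_integral => w _ do under eq_integral => y _ do rewrite scale0r addr0.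
  by rewrite integral_cst// -[LHS]mule1; congr (_ * _)%E; apply/esym; exact: probability_setT.
rewrite QE//; last by move=> z; rewrite lee_fin dot_ge0.
rewrite integral0_eq// => y _.
by rewrite /= subrr dot0l mule0.
Qed.

(* The sum accounts for the conditional means, the square root for the
   orthogonal centred increments. *)
Let a N k := N%:R^-1 * \sum_(j < k) b (j%:R / N%:R) + N%:R^-1 * r * Num.sqrt k.+1%:R.

(** Induction on the number of steps of length [1 / N]. Having [k.+1] under the root in [a] makes
    [a N k] positive already at [k = 0], where it is used as a divisor. *)
Let chain N k : (0 < N)%N -> (k <= N)%N ->
  exists2 pi, interpolation_coupling gam mu X (k%:R / N%:R) pi &
  (\int[pi]_z (dot (z.1 - z.2) (z.1 - z.2))%:E <= (a N k ^+ 2)%:E)%E.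
Proof.
move=> N0; have NR0 : (0 : R) < N%:R by rewrite ltr0n.
elim: k => [|k ih] kN.
  have [pi hpi pi0] := diagonal_coupling; exists pi; first by rewrite mul0r.
  by rewrite (le_trans pi0)// lee_fin sqr_ge0.
have [pi hpi pia] := ih (ltnW kN).
set s := k%:R / N%:R in hpi; set h := N%:R^-1 : R.
have h0 : 0 < h by rewrite invr_gt0.
have s01 : 0 <= s <= 1.
  by rewrite divr_ge0//= ler_pdivrMr// mul1r ler_nat ltnW.
have s0 : 0 <= s by case/andP: s01.
have bs0 := b_gt0 s0.
have S0 : 0 <= h * \sum_(j < k) b (j%:R / N%:R).
  rewrite mulr_ge0 ?(ltW h0)//; apply: sumr_ge0 => j _.
  by rewrite ltW// b_gt0// divr_ge0.
have ak0 : 0 < a N k.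
  by rewrite /a ltr_wpDl// mulr_gt0 ?mulr_gt0// sqrtr_gt0 ltr0n.
(* The optimal Young weight: the two cross contributions become [2 h (b s) (a N k)], as in the
   square of [a N k + h b s]. *)
have l0 : 0 < b s / a N k by rewrite divr_gt0.
have [pi' hpi' cost] := interpolation_step t0 CM mX r0 Xr X0 rt s01 (ltW h0) l0 hpi.
exists pi'; first by rewrite -natr1 mulrDl mul1r.
apply: (le_trans cost).
have k1 : 0 <= 1 + h * (b s / a N k) by rewrite addr_ge0// mulr_ge0// ltW.
have k2 : 0 <= h / (b s / a N k) by rewrite divr_ge0// ltW.
apply: (@le_trans _ _ ((1 + h * (b s / a N k))%:E * (a N k ^+ 2)%:E +
   (h / (b s / a N k))%:E * (b s ^+ 2)%:E + (h ^+ 2 * r ^+ 2)%:E)%E).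
  rewrite leeD2r// leeD// lee_wpmul2l ?lee_fin//.
  exact: cond_mean_le.
rewrite -!EFinM -!EFinD lee_fin.
have -> : (1 + h * (b s / a N k)) * a N k ^+ 2 + h / (b s / a N k) * b s ^+ 2 + h ^+ 2 * r ^+ 2 =
    a N k ^+ 2 + 2 * h * b s * a N k + h ^+ 2 * r ^+ 2.
  by field; rewrite !gt_eqF.
set S := h * \sum_(j < k) b (j%:R / N%:R) in S0.
have -> : a N k.+1 = S + h * b s + h * r * Num.sqrt k.+2%:R.
  by rewrite /a big_ord_recr/= mulrDr.
have -> : a N k = S + h * r * Num.sqrt k.+1%:R by [].
set q1 := Num.sqrt k.+1%:R; set q2 := Num.sqrt k.+2%:R.
have q12 : q1 <= q2 by rewrite ler_sqrt// ler_nat.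
have q1E : q1 ^+ 2 = k%:R + 1 by rewrite sqr_sqrtr// -natr1.
have q2E : q2 ^+ 2 = k%:R + 2 by rewrite sqr_sqrtr// -natr1 -[k.+1%:R]natr1 -addrA.
have Sb0 : 0 <= S + h * b s by rewrite addr_ge0// mulr_ge0// ltW.
have hr0 : 0 <= h * r by rewrite mulr_ge0// ltW.
have hb2 : 0 <= (h * b s) ^+ 2 by exact: sqr_ge0.
have m1 : 0 <= (S + h * b s) * (h * r) * (q2 - q1) by rewrite mulr_ge0 ?subr_ge0// mulr_ge0.
(* The difference is a sum of nonnegative terms, because the squares of [q1] and [q2] differ by
   exactly one and this pays for [h^2 r^2]. *)
rewrite -subr_ge0.
have -> : (S + h * b s + h * r * q2) ^+ 2 -
  ((S + h * r * q1) ^+ 2 + 2 * h * b s * (S + h * r * q1) + h ^+ 2 * r ^+ 2) =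
  (h * b s) ^+ 2 + 2 * ((S + h * b s) * (h * r) * (q2 - q1)) +
  h ^+ 2 * r ^+ 2 * (q2 ^+ 2 - q1 ^+ 2 - 1) by ring.
rewrite q1E q2E [X in _ + _ + _ * X](_ : _ = 0); last by ring.
by rewrite mulr0 addr0 addr_ge0// mulr_ge0.
Qed.

(** Take [k = N] in [chain]. The averaged sum is a left Riemann sum of the nondecreasing affine
    function [b], hence at most its integral [b (1/2)]. The other term is [r sqrt (N + 1) / N],
    which is at most [e] once [N >= 2 r^2 / e^2]. *)
Lemma near_optimal_coupling (e : R) : 0 < e ->
  exists2 pi, interpolation_coupling gam mu X 1 pi &
  (\int[pi]_z (dot (z.1 - z.2) (z.1 - z.2))%:E <=
    (((F / 2 + 2 * r ^+ 3 / Num.sqrt t) / Num.sqrt (t * c0) + e) ^+ 2)%:E)%E.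
Proof.
move=> e0.
have [N N0 e2] : exists2 N, (0 < N)%N & 2 * r ^+ 2 / e ^+ 2 <= N%:R.
  by exists (Num.truncn (2 * r ^+ 2 / e ^+ 2)).+1; rewrite // ltW// truncnS_gt.
have NR0 : (0 : R) < N%:R by rewrite ltr0n.
have [pi hpi cost] := chain N0 (leqnn N).
exists pi; first by rewrite divff ?gt_eqF in hpi.
apply: (le_trans cost); rewrite lee_fin.
have a0 : 0 <= a N N.
  rewrite /a addr_ge0// ?mulr_ge0 ?sqrtr_ge0 ?invr_ge0 ?(ltW r0)//.
  by apply: sumr_ge0 => j _; rewrite ltW// b_gt0// divr_ge0.
have tc : 0 < Num.sqrt (t * c0) by rewrite sqrtr_gt0 mulr_gt0.
have qt : 0 < Num.sqrt t by rewrite sqrtr_gt0.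
have F0 : 0 <= F by exact: sqrtr_ge0.
rewrite lerXn2r ?nnegrE//.
  rewrite addr_ge0 ?(ltW e0)// divr_ge0 ?(ltW tc)// addr_ge0 ?divr_ge0 ?(ltW qt)//.
  by rewrite mulr_ge0 ?exprn_ge0 ?(ltW r0).
rewrite /a lerD//.
  have -> : \sum_(j < N) b (j%:R / N%:R) =
      ((\sum_(j < N) j%:R) / N%:R * F + N%:R * (2 * r ^+ 3 / Num.sqrt t)) / Num.sqrt (t * c0).
    rewrite /b -mulr_suml big_split/= -!mulr_suml sumr_const card_ord; congr (_ / _).
    by rewrite -[2 *+ N]mulr_natl; ring.
  rewrite mulrA ler_wpM2r ?invr_ge0 ?(ltW tc)// mulrDr lerD//; last first.
    by rewrite mulKf ?gt_eqF.
  rewrite [leLHS](_ : _ = (\sum_(j < N) j%:R) / N%:R ^+ 2 * F); last by field; rewrite gt_eqF.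
  rewrite [leRHS]mulrC ler_wpM2r// ler_pdivrMr ?exprn_gt0// -natr_sum ler_pdivlMl//.
  rewrite -natrX -natrM ler_nat.
  have -> : (\sum_(j < N) j = 'C(N, 2))%N by rewrite -bin2_sum big_mkord.
  rewrite mulnC muln2 bin2; apply: (@leq_trans (N * N.-1)).
    by rewrite -geq_half_double.
  by rewrite leq_mul2l leq_pred orbT.
have l0 : 0 <= N%:R^-1 * r * Num.sqrt N.+1%:R.
  by rewrite mulr_ge0 ?sqrtr_ge0// mulr_ge0 ?invr_ge0 ?(ltW r0).
rewrite -(@ler_pXn2r _ 2)// ?nnegrE ?(ltW e0)//.
rewrite !exprMn sqr_sqrtr// exprVn -mulrA ler_pdivrMl ?exprn_gt0//.
move: e2; rewrite ler_pdivrMr ?exprn_gt0// => e2.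
apply: (@le_trans _ _ (r ^+ 2 * (2 * N%:R))).
  by rewrite ler_wpM2l ?sqr_ge0// -natrM ler_nat mul2n -addnn -addn1 leq_add2l.
have := ler_wpM2r (ltW NR0) e2; rewrite expr2; lra.
Qed.

End chain.

(** * The lower bound *)

(** In the sum of the two exponential series the odd terms cancel and the even ones are nonnegative,
    so truncation after degree two is a lower bound. *)
Lemma cosh_ge (R : realType) (x : R) : 2 + x ^+ 2 <= expR x + expR (- x).
Proof.
have cx := is_cvg_series_exp_coeff x; have cy := is_cvg_series_exp_coeff (- x).
have e0 m : 0 <= exp_coeff x m + exp_coeff (- x) m.
  rewrite /exp_coeff/= -mulrDl divr_ge0// exprNn.
  rewrite -signr_odd; case: (boolP (odd m)) => om; first by rewrite expr1 mulN1r subrr.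
  by rewrite expr0 mul1r addr_ge0// exprn_even_ge0.
rewrite /expR -limD//; apply: limr_ge; first exact: is_cvgD.
exists 3%N => // m /= m3.
suff : 2 + x ^+ 2 <= \sum_(0 <= i < m) (exp_coeff x i + exp_coeff (- x) i) by rewrite big_split.
rewrite (big_cat_nat (n := 3%N))//=.
rewrite -[leLHS]addr0 lerD//; last by apply: sumr_ge0 => i _; exact: e0.
rewrite !big_nat_recr//= big_nil add0r /exp_coeff/= !expr0 !expr1 sqrrN.
rewrite (_ : 0`! = 1)%N// (_ : 1`! = 1)%N// (_ : 2`! = 2)%N//.
by rewrite le_eqVlt; apply/orP; left; apply/eqP; field.
Qed.

(** * Exponential and second moments of the Gaussian *)

Section gaussian_moments.
Context (R : realType) (n : nat) (t : R) (gam : probability 'cV[R]_n R).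
Notation V := 'cV[R]_n.
Hypotheses (t0 : 0 < t) (CM : forall a, cameron_martin t gam a).

(** Up to a constant, [expR (dot b y)] is the tilt by [t *: b], of integral one. *)
Lemma gaussian_mgf (b : V) :
  (\int[gam]_y (expR (dot b y))%:E = (expR (2^-1 * t * dot b b))%:E)%E.
Proof.
have me : measurable_fun [set: V] (fun y => tilt t (t *: b) y) by exact: measurable_tilt.
transitivity (\int[gam]_y ((expR (2^-1 * t * dot b b))%:E * ((tilt t (t *: b) y)%:E * cst 1%E y)))%E.
  apply: eq_integral => y _; rewrite mule1 -EFinM /tilt -expRD; congr (expR _)%:E.
  by rewrite !dotE; field; rewrite gt_eqF.
rewrite ge0_integralZl//.
- by rewrite CM// integral_cst// mul1e -[RHS]mule1; congr (_ * _)%E; exact: probability_setT.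
- by apply: emeasurable_funM => //; exact/measurable_EFinP.
- by move=> y _; rewrite mule1 lee_fin tilt_ge0.
Qed.

(** [cosh_ge] at [sqrt s <a, y>], integrated with [gaussian_mgf], gives
    [s I + 2 <= 2 exp (s q / 2)]; the claim follows by letting [s] tend to zero, in place of
    differentiating the generating function. *)
Lemma gaussian_second_moment_le (a : V) :
  (\int[gam]_y (dot a y ^+ 2)%:E <= (t * dot a a)%:E)%E.
Proof.
set I := (\int[gam]_y _)%E; set q := t * dot a a.
have q0 : 0 <= q by rewrite mulr_ge0 ?dot_ge0 ?ltW.
have mdot b : measurable_fun [set: V] (fun y => dot b y) by exact: measurable_dot.
have main s : 0 < s -> s * q < 2 -> (I <= (q / (1 - s * q / 2))%:E)%E.
  move=> s0 sq.
  have key : (s%:E * I + 2%:E <= (2 * expR (s * q / 2))%:E)%E.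
    rewrite /I -ge0_integralZl//; last 3 first.
    - by apply/measurable_EFinP; exact: measurable_funX.
    - by move=> y _; rewrite lee_fin sqr_ge0.
    - by rewrite lee_fin ltW.
    have i2 : (\int[gam]_y (cst 2%:E) y = 2%:E)%E.
      by rewrite integral_cst// -[RHS]mule1; congr (_ * _)%E; exact: probability_setT.
    rewrite -{1}i2 -ge0_integralD//; last 3 first.
    - by move=> y _; rewrite mule_ge0// lee_fin ?sqr_ge0// ltW.
    - by apply: measurable_funeM; apply/measurable_EFinP; exact: measurable_funX.
    - by move=> y _; rewrite lee_fin.
    pose b := Num.sqrt s *: a.
    have mexp c : measurable_fun [set: V] (fun y => (expR (dot c y))%:E).
      by apply/measurable_EFinP; exact: measurableT_comp.
    have e0 (x : R) : (0 <= (expR x)%:E)%E by rewrite lee_fin expR_ge0.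
    have bE : 2^-1 * t * dot b b = s * q / 2.
      rewrite /b !dotE -[in RHS](sqr_sqrtr (ltW s0)) /q; ring.
    apply: (@le_trans _ _ (\int[gam]_y ((expR (dot b y))%:E + (expR (dot (- b) y))%:E))%E).
      apply: ge0_le_integral => //.
      - move=> y _; rewrite -EFinM -EFinD lee_fin.
        by rewrite addr_ge0// mulr_ge0 ?sqr_ge0// ltW.
      - apply: emeasurable_funD => //; apply: measurable_funeM; apply/measurable_EFinP.
        exact: measurable_funX.
      - exact: emeasurable_funD.
      - move=> y _; rewrite -EFinM -!EFinD lee_fin dotNl addrC.
        have -> : s * dot a y ^+ 2 = dot b y ^+ 2.
          by rewrite /b dotZl exprMn sqr_sqrtr// ltW.
        exact: cosh_ge.
    rewrite ge0_integralD// !gaussian_mgf dotNl dotNr opprK bE -EFinD lee_fin; lra.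
  have x1 : 0 < 1 - s * q / 2 by lra.
  have ex : expR (s * q / 2) <= (1 - s * q / 2)^-1.
    have h1 := expR_ge1Dx (- (s * q / 2)); rewrite expRN in h1.
    by rewrite -[leLHS]invrK lef_pV2 ?posrE ?invr_gt0 ?expR_gt0.
  have {}key : (s%:E * I + 2%:E <= (s * (q / (1 - s * q / 2)) + 2)%:E)%E.
    apply: (le_trans key); rewrite lee_fin.
    have -> : s * (q / (1 - s * q / 2)) + 2 = 2 * (1 - s * q / 2)^-1.
      have h2 : s * q = 2 - 2 * (1 - s * q / 2) by field.
      rewrite mulrA {1}h2; move: x1; set z := 1 - _ => z0; field; rewrite gt_eqF//.
    by rewrite ler_wpM2l.
  move: key; rewrite (EFinD (s * (q / (1 - s * q / 2))) 2) leeD2rE//.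
  by rewrite EFinM lee_pmul2l// lte_fin.
(* The bound [main] tends to q as s tends to 0; this s makes it at most q + e. *)
apply/lee_addgt0Pr => e e0.
have qe : 0 < q + e by rewrite ltr_wpDl.
pose s := 2 * e / ((q + e) * (q + e)).
have s0 : 0 < s by rewrite divr_gt0 ?mulr_gt0.
have qee : q / (q + e) <= 1 by rewrite ler_pdivrMr// mul1r lerDl ltW.
have qe0 : 0 <= q / (q + e) by rewrite divr_ge0// ltW.
have ee1 : e / (q + e) <= 1 by rewrite ler_pdivrMr// mul1r lerDr.
have sq : s * q = 2 * (e / (q + e) * (q / (q + e))).
  by rewrite /s; field; rewrite gt_eqF.
have sq2 : s * q < 2.
  rewrite sq -[ltRHS]mulr1 ltr_pM2l//.
  have [q00|qp] := eqVneq q 0; first by rewrite q00 mul0r mulr0.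
  have qp' : 0 < q by rewrite lt_neqAle eq_sym qp.
  have : q / (q + e) < 1 by rewrite ltr_pdivrMr// mul1r ltrDl.
  by apply: le_lt_trans; rewrite ler_piMl.
apply: (le_trans (main s s0 sq2)); rewrite -EFinD lee_fin.
have x1 : 0 < 1 - s * q / 2 by lra.
rewrite ler_pdivrMr//.
have -> : s * q / 2 = e / (q + e) * (q / (q + e)).
  by rewrite sq; field; rewrite gt_eqF.
have -> : (q + e) * (1 - e / (q + e) * (q / (q + e))) = q + e * (1 - q / (q + e)).
  by field; rewrite gt_eqF.
by rewrite lerDl mulr_ge0 ?(ltW e0)// subr_ge0.
Qed.

Let mcoord i : measurable_fun [set: V] (fun y => y i ord0).
Proof. exact: measurable_fun_coord. Qed.

Lemma gaussian_integrable_sqr i : gam.-integrable setT (fun y => (y i ord0 ^+ 2)%:E).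
Proof.
apply/integrableP; split.
  by apply/measurable_EFinP; exact: measurable_funX.
under eq_integral do rewrite gee0_abs ?lee_fin ?sqr_ge0//.
pose a : V := delta_mx i ord0.
have aE y : dot a y = y i ord0.
  rewrite /dot (bigD1 i)//= /a mxE !eqxx mul1r big1 ?addr0// => j /negbTE ji.
  by rewrite mxE ji mul0r.
under eq_integral do rewrite -aE.
exact: le_lt_trans (gaussian_second_moment_le a) (ltry _).
Qed.

Lemma gaussian_integrable_coordM i j :
  gam.-integrable setT (EFin \o (fun y => y i ord0 * y j ord0)).
Proof.
apply: (le_integrable measurableT _ _
  (integrableD measurableT (gaussian_integrable_sqr i) (gaussian_integrable_sqr j))).
  by apply/measurable_EFinP; exact: measurable_funM.
move=> y _; rewrite lee_fin [leRHS]ger0_norm ?addr_ge0 ?sqr_ge0//=.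
rewrite normrM -(real_normK (num_real (y i ord0))) -(real_normK (num_real (y j ord0))).
have := sqr_ge0 (`|y i ord0| - `|y j ord0|).
have := sqr_ge0 `|y i ord0|; have := sqr_ge0 `|y j ord0|; lra.
Qed.

Lemma gaussian_integrable_coord i : gam.-integrable setT (EFin \o (fun y => y i ord0)).
Proof.
have i1 : gam.-integrable setT (EFin \o (fun=> 1)).
  exact: (finite_measure_integrable_cst gam 1 measurableT).
apply: (le_integrable measurableT _ _
  (integrableD measurableT i1 (gaussian_integrable_sqr i))).
  exact/measurable_EFinP.
move=> y _; rewrite lee_fin [leRHS]ger0_norm ?addr_ge0 ?sqr_ge0//=.
rewrite -(real_normK (num_real (y i ord0))).
have := sqr_ge0 (`|y i ord0| - 1); have := normr_ge0 (y i ord0); nra.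
Qed.

End gaussian_moments.

(** * Quadratic forms as test functions for couplings *)

Section lower_bound.
Context (R : realType) (n : nat) (t : R) (gam : probability 'cV[R]_n R).
Context d (E : measurableType d) (mu : probability E R) (X : E -> 'cV[R]_n) (r : R).
Notation V := 'cV[R]_n.
Hypotheses (t0 : 0 < t) (CM : forall a, cameron_martin t gam a).
Hypotheses (mX : measurable_fun [set: E] X) (r0 : 0 < r).
Hypothesis Xr : forall w, dot (X w) (X w) <= r ^+ 2.
Hypothesis X0 : forall i, \int[mu]_w (X w i ord0) = 0.

Let bX i : bounded_mfun (fun w => X w i ord0).
Proof.
split; first exact: measurable_fun_coord.
by exists r => w; apply: abs_coord_le => //; exact: ltW.
Qed.

Implicit Types (N : 'M[R]_n) (x y z : V).

Let qf N y := dot (N *m y) y.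

Let qfE N y : qf N y = \sum_i \sum_j N i j * (y i ord0 * y j ord0).
Proof.
rewrite /qf /dot; apply: eq_bigr => i _; rewrite mxE mulr_suml.
by apply: eq_bigr => j _; ring.
Qed.

Let measurable_qf d' (T : measurableType d') N (f : T -> V) : measurable_fun [set: T] f ->
  measurable_fun [set: T] (fun w => (qf N (f w))%:E).
Proof.
move=> mf; apply/measurable_EFinP; apply: measurable_dot => //.
exact: measurable_mulmxv.
Qed.

(** When the two marginals are compared, [G] cancels for the form of [M] and is controlled by
    [N2_gam] for that of [N2], while [g] meets only the mean of [X], which is zero. *)
Let G i j := \int[gam]_y (y i ord0 * y j ord0).
Let g i := \int[gam]_y (y i ord0).
Let M : 'M[R]_n := \matrix_(i, j) \int[mu]_w (X w i ord0 * X w j ord0).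

Let gint (f : V -> R) : Prop := gam.-integrable setT (EFin \o f).

Let gint_cst c : gint (fun=> c).
Proof. exact: (finite_measure_integrable_cst gam c measurableT). Qed.

Let gintZ c (f : V -> R) : gint f -> gint (fun y => c * f y).
Proof. by move=> hf; exact: (integrableZl measurableT c hf). Qed.

Let gintD (f h : V -> R) : gint f -> gint h -> gint (fun y => f y + h y).
Proof. by move=> hf hh; exact: (integrableD measurableT hf hh). Qed.

Let gintM i j : gint (fun y => y i ord0 * y j ord0).
Proof. exact: (gaussian_integrable_coordM t0 CM). Qed.

Let gint1 i : gint (fun y => y i ord0).
Proof. exact: (gaussian_integrable_coord t0 CM). Qed.

Let Rintegral_sumI (I : Type) (s : seq I) (f : I -> V -> R) :
  (forall i, gint (f i)) ->
  gint (fun y => \sum_(i <- s) f i y) /\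
  \int[gam]_y (\sum_(i <- s) f i y) = \sum_(i <- s) \int[gam]_y f i y.
Proof.
move=> hf.
have hs s' : gint (fun y => \sum_(i <- s') f i y).
  rewrite /gint (_ : EFin \o _ = fun y => (\sum_(i <- s') (f i y)%:E)%E).
    by apply: integrable_sum => // i _; exact: hf.
  by apply/funext => y; rewrite /= sumEFin.
split; first exact: hs.
elim: s => [|i s ih].
  by under eq_Rintegral do rewrite big_nil; rewrite Rintegral_cstP big_nil.
under eq_Rintegral do rewrite big_cons.
rewrite RintegralD//; [by rewrite ih big_cons|exact: hf|exact: hs].
Qed.

Let quad_shift N x :
  gint (fun y => qf N (y + x)) /\
  \int[gam]_y qf N (y + x) = \sum_i \sum_j N i j *
    (G i j + (x j ord0 * g i + (x i ord0 * g j + x i ord0 * x j ord0))).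
Proof.
have sI2 i j : gint (fun y : V => x i ord0 * y j ord0 + x i ord0 * x j ord0).
  by apply: gintD; [exact: gintZ|exact: gint_cst].
have sI i j : gint (fun y : V => x j ord0 * y i ord0 + (x i ord0 * y j ord0 + x i ord0 * x j ord0)).
  by apply: gintD; [exact: gintZ|exact: sI2].
have term i j : gint (fun y : V => N i j *
      (y i ord0 * y j ord0 + (x j ord0 * y i ord0 + (x i ord0 * y j ord0 + x i ord0 * x j ord0)))).
  apply: gintZ; apply: gintD; first exact: gintM.
  exact: sI.
have sumI i := Rintegral_sumI (index_enum 'I_n) (term i).
have [s1 s2] := Rintegral_sumI (index_enum 'I_n) (fun i => proj1 (sumI i)).
have E1 y : qf N (y + x) = \sum_i \sum_j N i j *
    (y i ord0 * y j ord0 + (x j ord0 * y i ord0 + (x i ord0 * y j ord0 + x i ord0 * x j ord0))).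
  by rewrite qfE; apply: eq_bigr => i _; apply: eq_bigr => j _; rewrite !mxE; ring.
split; first by under eq_fun do rewrite E1.
under eq_Rintegral do rewrite E1.
rewrite s2; apply: eq_bigr => i _; rewrite (proj2 (sumI i)); apply: eq_bigr => j _.
rewrite RintegralZl//; last by apply: gintD; [exact: gintM|exact: sI].
rewrite RintegralD//; [|exact: gintM|exact: sI].
rewrite RintegralD//; [|exact: gintZ|exact: sI2].
rewrite RintegralD//; [|exact: gintZ|exact: gint_cst].
rewrite RintegralZl//; last exact: gint1.
rewrite RintegralZl//; last exact: gint1.
by rewrite (Rintegral_cstP gam).
Qed.

Let quad_gam N : (\int[gam]_y (qf N y)%:E = (\sum_i \sum_j N i j * G i j)%:E)%E.
Proof.
have [h1 h2] := quad_shift N 0.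
under eq_integral do rewrite -[X in qf N X]addr0.
rewrite -[LHS]fineK; last exact: (integrable_fin_num measurableT h1).
rewrite -/(\int[gam]_y qf N (y + 0)) h2; congr EFin.
by apply: eq_bigr => i _; apply: eq_bigr => j _; rewrite !mxE !mul0r !addr0.
Qed.

Let quad_mu N : \int[mu]_w qf N (X w) = \sum_i \sum_j N i j * M i j.
Proof.
under eq_Rintegral do rewrite qfE.
rewrite Rintegral_sumB; last first.
  move=> i; apply: bounded_mfun_sum => j; apply: bounded_mfunM; first exact: bounded_mfun_cst.
  exact: bounded_mfunM.
apply: eq_bigr => i _; rewrite Rintegral_sumB; last first.
  move=> j; apply: bounded_mfunM; first exact: bounded_mfun_cst.
  exact: bounded_mfunM.
apply: eq_bigr => j _; rewrite RintegralZl ?mxE//.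
by apply: bounded_mfun_integrable; exact: bounded_mfunM.
Qed.

(** The terms linear in [X] have mean zero, so adding [X] to the Gaussian contributes exactly the
    entries of [M]. *)
Let quad_rho N : (\int[mu]_w \int[gam]_y (qf N (y + X w)%R)%:E =
  (\sum_i \sum_j N i j * (G i j + M i j))%:E)%E.
Proof.
transitivity (\int[mu]_w (\sum_i \sum_j N i j *
    (G i j + (X w j ord0 * g i + (X w i ord0 * g j + X w i ord0 * X w j ord0))))%:E)%E.
  apply: eq_integral => w _; have [h1 h2] := quad_shift N (X w).
  by rewrite -h2 /Rintegral fineK//; exact: (integrable_fin_num measurableT h1).
have bg c i : bounded_mfun (fun w => X w i ord0 * c).
  by apply: bounded_mfunM => //; exact: bounded_mfun_cst.
have bXX i j : bounded_mfun (fun w => X w i ord0 * X w j ord0) by exact: bounded_mfunM.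
have term i j : bounded_mfun (fun w => N i j *
    (G i j + (X w j ord0 * g i + (X w i ord0 * g j + X w i ord0 * X w j ord0)))).
  apply: bounded_mfunM; first exact: bounded_mfun_cst.
  apply: bounded_mfunD; first exact: bounded_mfun_cst.
  by apply: bounded_mfunD => //; exact: bounded_mfunD.
rewrite -EFin_Rintegral; last by apply: bounded_mfun_sum => i; exact: bounded_mfun_sum.
congr EFin; rewrite Rintegral_sumB; last by move=> i; exact: bounded_mfun_sum.
apply: eq_bigr => i _; rewrite Rintegral_sumB//; apply: eq_bigr => j _.
have iB (f : E -> R) : bounded_mfun f -> mu.-integrable setT (EFin \o f).
  exact: bounded_mfun_integrable.
rewrite RintegralZl//; last first.
  apply: (iB); apply: bounded_mfunD; first exact: bounded_mfun_cst.
  by apply: bounded_mfunD => //; exact: bounded_mfunD.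
congr (_ * _).
rewrite RintegralD//; [|by apply: (iB); exact: bounded_mfun_cst|]; last first.
  by apply: (iB); apply: bounded_mfunD => //; exact: bounded_mfunD.
rewrite RintegralD//; [|exact: iB|by apply: (iB); exact: bounded_mfunD].
rewrite RintegralD//; [|exact: iB|exact: iB].
rewrite !RintegralZr ?iB// !X0 !mul0r !add0r Rintegral_cstP.
by rewrite mxE.
Qed.

(** The form is the mean of [dot (X w) y ^+ 2]. Its sign matters because marginals are tested
    against nonnegative functions. *)
Let qfM_ge0 y : 0 <= qf M y.
Proof.
rewrite (_ : qf M y = \int[mu]_w (dot (X w) y ^+ 2)).
  by apply: Rintegral_ge0 => w _; exact: sqr_ge0.
rewrite qfE.
transitivity (\int[mu]_w (\sum_i \sum_j (y i ord0 * y j ord0) * (X w i ord0 * X w j ord0))).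
  rewrite Rintegral_sumB; last first.
    move=> i; apply: bounded_mfun_sum => j; apply: bounded_mfunM; first exact: bounded_mfun_cst.
    exact: bounded_mfunM.
  apply: eq_bigr => i _; rewrite Rintegral_sumB; last first.
    move=> j; apply: bounded_mfunM; first exact: bounded_mfun_cst.
    exact: bounded_mfunM.
  apply: eq_bigr => j _; rewrite RintegralZl//; last first.
    by apply: bounded_mfun_integrable; exact: bounded_mfunM.
  by rewrite mxE mulrC.
apply: eq_Rintegral => w _; rewrite expr2 /dot mulr_suml; apply: eq_bigr => i _.
by rewrite mulr_sumr; apply: eq_bigr => j _; ring.
Qed.

Let dotM_sym y z : dot (M *m y) z = dot (M *m z) y.
Proof.
rewrite /dot.
under eq_bigr do rewrite mxE mulr_suml.
under [RHS]eq_bigr do rewrite mxE mulr_suml.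
rewrite exchange_big/=; apply: eq_bigr => i _; apply: eq_bigr => j _.
rewrite !mxE (_ : \int[mu]_w (X w j ord0 * X w i ord0) = \int[mu]_w (X w i ord0 * X w j ord0)).
  by ring.
by apply: eq_Rintegral => w _; rewrite mulrC.
Qed.

(** By symmetry of [M] the form of this matrix is [|M y|^2], the quantity left over by Young's
    inequality. *)
Let N2 := M *m M.

Let qfN2 y : qf N2 y = dot (M *m y) (M *m y).
Proof. by rewrite /qf /N2 -mulmxA dotM_sym. Qed.

Let qfN2_ge0 y : 0 <= qf N2 y.
Proof. by rewrite qfN2 dot_ge0. Qed.

Let F2 := \sum_i \sum_j (\int[mu]_w (X w i ord0 * X w j ord0)) ^+ 2.

Let rowM i : V := (row i M)^T.

Let mulM_coord y i : (M *m y) i ord0 = dot (rowM i) y.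
Proof. by rewrite mxE; apply: eq_bigr => j _; rewrite !mxE. Qed.

Let rowM_sum : \sum_i dot (rowM i) (rowM i) = F2.
Proof.
apply: eq_bigr => i _; apply: eq_bigr => j _.
by rewrite /rowM !mxE -expr2.
Qed.

(** [|M y|^2] is the sum over the rows of the squares of [dot (rowM i) y], each of mean at most [t]
    times the squared norm of the row. *)
Let N2_gam : \sum_i \sum_j N2 i j * G i j <= t * F2.
Proof.
rewrite -lee_fin -quad_gam.
under eq_integral do rewrite qfN2 /dot.
have E1 y : (\sum_i (M *m y) i ord0 * (M *m y) i ord0)%:E =
    (\sum_i (dot (rowM i) y ^+ 2)%:E)%E.
  by rewrite sumEFin; congr EFin; apply: eq_bigr => i _; rewrite mulM_coord expr2.
under eq_integral do rewrite E1.
rewrite ge0_integral_sum//.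
- rewrite -rowM_sum mulr_sumr -sumEFin.
  by apply: lee_sum => i _; exact: gaussian_second_moment_le.
- move=> i; apply/measurable_EFinP; apply: measurable_funX; exact: measurable_dot.
- by move=> i y _; rewrite lee_fin sqr_ge0.
Qed.

Let N2_mu : \sum_i \sum_j N2 i j * M i j <= F2 * r ^+ 2.
Proof.
rewrite -quad_mu -[leRHS](Rintegral_cstP mu).
have b1 : bounded_mfun (fun w => qf N2 (X w)).
  split; first by apply: measurable_dot => //; exact: measurable_mulmxv.
  exists (F2 * r ^+ 2) => w; rewrite ger0_norm// qfN2 /dot -rowM_sum mulr_suml.
  apply: ler_sum => i _; rewrite mulM_coord -expr2.
  by rewrite (le_trans (dot_cauchy_schwarz _ _))// ler_wpM2l// dot_ge0.
apply: le_Rintegral => //.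
- exact: bounded_mfun_integrable.
- by apply: bounded_mfun_integrable; exact: bounded_mfun_cst.
move=> w _; rewrite qfN2 /dot -rowM_sum mulr_suml.
apply: ler_sum => i _; rewrite mulM_coord -expr2.
by rewrite (le_trans (dot_cauchy_schwarz _ _))// ler_wpM2l// dot_ge0.
Qed.

(* <M y, y> - <M z, z> = <y - z, M (y + z)> for symmetric M, by Young's
   inequality and |M (y + z)|^2 <= 2 (|M y|^2 + |M z|^2). *)
Let quad_young l y z : 0 < l ->
  qf M y <= qf M z + (l / 2 * dot (y - z) (y - z) + l^-1 * (qf N2 y + qf N2 z)).
Proof.
move=> l0.
have h := dot_young (y - z) (M *m (y + z)) l0.
have p := dot_ge0 (M *m y - M *m z).
have l1 : 0 <= l^-1 by rewrite invr_ge0 ltW.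
move: h p; rewrite !qfN2 !mulmxDr.
rewrite (dotDl y (- z)) (dotDr _ _ y) (dotDr _ _ (- z)) dotNl dotNl.
rewrite -/(dot (y - z) (y - z)).
rewrite !(dotC y) !(dotC z) !(dotM_sym z y) -/(qf M y) -/(qf M z).
set D := dot (y - z) _.
rewrite !dotE (dotC (M *m z) (M *m y)).
set a := dot (M *m y) (M *m y); set b := dot (M *m z) (M *m z); set e := dot (M *m y) (M *m z).
move=> h p.
have h2 : l^-1 * (a + e + (e + b)) <= l^-1 * (2 * (a + b)) by rewrite ler_wpM2l//; lra.
lra.
Qed.

(** Integrate [quad_young] against the coupling: the form of [M] has mean larger by [F2] at the
    first point, and the Young error is at most [F2 (2 t + r^2) / l]. *)
Lemma coupling_lower_bound (pi : probability (V * V)%type R) :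
  (forall h : V -> \bar R, measurable_fun [set: V] h -> (forall y, 0 <= h y)%E ->
     \int[pi]_z h z.1 = \int[mu]_w \int[gam]_y h (y + X w)%R)%E ->
  (forall h : V -> \bar R, measurable_fun [set: V] h -> (forall y, 0 <= h y)%E ->
     \int[pi]_z h z.2 = \int[gam]_y h y)%E ->
  ((F2 / (4 * t + 2 * r ^+ 2))%:E <=
    \int[pi]_z (dot (z.1 - z.2) (z.1 - z.2))%:E)%E.
Proof.
move=> h1 h2.
have mD : measurable_fun [set: V * V] (fun p => (dot (p.1 - p.2) (p.1 - p.2))%:E).
  apply/measurable_EFinP; apply: measurable_dot;
    by apply: measurable_addv => //; exact: measurable_oppv.
set cost := (\int[pi]_z _)%E.
have q0 : 0 < 2 * t + r ^+ 2 by rewrite addr_gt0 ?exprn_gt0// mulr_gt0.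
(* This value bounds the Young error by [F2 / 2], half of the gain, and leaves
   [F2 / 2 <= (l / 2) cost]. *)
pose l := 2 * (2 * t + r ^+ 2).
have l0 : 0 < l by rewrite mulr_gt0.
have lV0 : 0 <= l^-1 by rewrite invr_ge0 ltW.
have l20 : 0 <= l / 2 by rewrite divr_ge0// ltW.
have m1 N : measurable_fun [set: V * V] (fun p => (qf N p.1)%:E) by exact: measurable_qf.
have m2 N : measurable_fun [set: V * V] (fun p => (qf N p.2)%:E) by exact: measurable_qf.
have mV N : measurable_fun [set: V] (fun y => (qf N y)%:E) by exact: measurable_qf.
have e1 N : (forall y, 0 <= qf N y) -> (\int[pi]_p (qf N p.1)%:E =
    (\sum_i \sum_j N i j * (G i j + M i j))%:E)%E.
  by move=> N0; rewrite (h1 (fun y => (qf N y)%:E))// quad_rho.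
have e2 N : (forall y, 0 <= qf N y) -> (\int[pi]_p (qf N p.2)%:E =
    (\sum_i \sum_j N i j * G i j)%:E)%E.
  by move=> N0; rewrite (h2 (fun y => (qf N y)%:E))// quad_gam.
have D0 (p : V * V) : (0 <= (dot (p.1 - p.2) (p.1 - p.2))%:E)%E by rewrite lee_fin dot_ge0.
have eD N : \sum_i \sum_j N i j * (G i j + M i j) =
    \sum_i \sum_j N i j * G i j + \sum_i \sum_j N i j * M i j.
  rewrite -big_split/=; apply: eq_bigr => i _; rewrite -big_split/=.
  by apply: eq_bigr => j _; rewrite mulrDr.
have MM : \sum_i \sum_j M i j * M i j = F2.
  by apply: eq_bigr => i _; apply: eq_bigr => j _; rewrite !mxE expr2.
set gM := \sum_i \sum_j M i j * G i j.
set gN := \sum_i \sum_j N2 i j * G i j.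
set mN := \sum_i \sum_j N2 i j * M i j.
have main : ((gM + F2)%:E <= gM%:E + ((l / 2)%:E * cost + (l^-1 * (gN + mN + gN))%:E))%E.
  have := e1 M qfM_ge0; rewrite eD MM -/gM => <-.
  have := e1 N2 qfN2_ge0; rewrite eD -/gN -/mN => eN1.
  have eN2 := e2 N2 qfN2_ge0; rewrite -/gN in eN2.
  have eM2 := e2 M qfM_ge0; rewrite -/gM in eM2.
  rewrite [X in (_ <= _ + (_ + X))%E]EFinM [X in (_ <= _ + (_ + _ * X))%E]EFinD -eN1.
  rewrite -[in X in (_ <= _ + (_ + _ * (_ + X)))%E]eN2 -eM2.
  rewrite -ge0_integralD//; last 2 first.
  - by move=> p _; rewrite lee_fin.
  - by move=> p _; rewrite lee_fin.
  rewrite /cost -ge0_integralZl//; last 2 first.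
  - exact: emeasurable_funD.
  - by move=> p _; rewrite -EFinD lee_fin addr_ge0.
  rewrite -ge0_integralZl//.
  have mA : measurable_fun [set: V * V] (fun p => (l / 2)%:E * (dot (p.1 - p.2) (p.1 - p.2))%:E)%E.
    exact: measurable_funeM.
  have mB : measurable_fun [set: V * V] (fun p => l^-1%:E * ((qf N2 p.1)%:E + (qf N2 p.2)%:E))%E.
    by apply: measurable_funeM; exact: emeasurable_funD.
  have A0 (p : V * V) : (0 <= (l / 2)%:E * (dot (p.1 - p.2) (p.1 - p.2))%:E)%E by rewrite mule_ge0.
  have B0 (p : V * V) : (0 <= l^-1%:E * ((qf N2 p.1)%:E + (qf N2 p.2)%:E))%E.
    by rewrite mule_ge0// ?lee_fin// addr_ge0.
  rewrite -ge0_integralD// -ge0_integralD//; last 3 first.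
  - by move=> p _; rewrite lee_fin.
  - by move=> p _; rewrite adde_ge0.
  - exact: emeasurable_funD.
  apply: ge0_le_integral => //.
  - by move=> p _; rewrite lee_fin.
  - by apply: emeasurable_funD => //; exact: emeasurable_funD.
  - by move=> p _; have := quad_young p.1 p.2 l0; rewrite -lee_fin.
have cost0 : (0 <= cost)%E by apply: integral_ge0 => p _.
(* An infinite cost satisfies the bound trivially; otherwise the inequality is one between reals. *)
case: cost cost0 main => [c c0|_ _|//]; last by rewrite leey.
rewrite -EFinM -!EFinD !lee_fin => main.
have Nb : l^-1 * (gN + mN + gN) <= l^-1 * (F2 * (2 * t + r ^+ 2)).
  by rewrite ler_wpM2l//; move: N2_gam N2_mu; rewrite -/gN -/mN; lra.
have l2E : l^-1 * (F2 * (2 * t + r ^+ 2)) = F2 / 2.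
  by rewrite /l; field; rewrite gt_eqF.
have l3 : l / 2 = 2 * t + r ^+ 2 by rewrite /l; field.
rewrite l2E in Nb; rewrite l3 in main.
rewrite ler_pdivrMr; last by lra.
lra.
Qed.

End lower_bound.

(** * Wasserstein distance of the smoothed laws *)

Section wasserstein.
Context (R : realType) (n : nat).
Notation V := 'cV[R]_n.
Implicit Types mu nu : probability V R.

(** Converts marginals given on sets into integrals of nonnegative functions, the form in which
    couplings are built and tested. *)
Lemma couplingP mu nu (pi : probability (V * V)%type R) :
  coupling mu nu pi <->
  ((forall g : V -> \bar R, measurable_fun [set: V] g -> (forall y, 0 <= g y)%E ->
      \int[pi]_z g z.1 = \int[mu]_y g y)%E /\
   (forall g : V -> \bar R, measurable_fun [set: V] g -> (forall y, 0 <= g y)%E ->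
      \int[pi]_z g z.2 = \int[nu]_y g y)%E).
Proof.
split=> [cpi|[h1 h2] A mA].
- split=> g mg g0.
    transitivity (\int[pushforward pi (fst : V * V -> V)]_y g y)%E.
      by rewrite ge0_integral_pushforward.
    by apply: eq_measure_integral => A mA _; exact: (proj1 (cpi A mA)).
  transitivity (\int[pushforward pi (snd : V * V -> V)]_y g y)%E.
    by rewrite ge0_integral_pushforward.
  by apply: eq_measure_integral => A mA _; exact: (proj2 (cpi A mA)).
- have mI : measurable_fun [set: V] (fun y => (\1_A y : R)%:E).
    by apply/measurable_EFinP; exact: measurable_indic.
  have I0 y : (0 <= (\1_A y : R)%:E)%E by rewrite lee_fin.
  have m1 : measurable ((fst : V * V -> V) @^-1` A).
    by rewrite -[X in measurable X]setTI; exact: measurable_fst.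
  have m2 : measurable ((snd : V * V -> V) @^-1` A).
    by rewrite -[X in measurable X]setTI; exact: measurable_snd.
  have pE (q : probability (V * V)%type R) C : measurable C ->
      q C = (\int[q]_z (\1_C z)%:E)%E by move=> mC; rewrite integral_indic// setIT.
  split.
    rewrite pE//; apply: (eq_trans (h1 _ mI I0)).
    by rewrite integral_indic// setIT.
  rewrite pE//; apply: (eq_trans (h2 _ mI I0)).
  by rewrite integral_indic// setIT.
Qed.

Lemma measurable_sqr_dist :
  measurable_fun [set: V * V] (fun z => (enorm (z.1 - z.2) ^+ 2)%:E).
Proof.
under eq_fun do rewrite enorm_sqr.
apply/measurable_EFinP; apply: measurable_dot;
  by apply: measurable_addv => //; exact: measurable_oppv.
Qed.

Lemma W2_le mu nu (pi : probability (V * V)%type R) (c : \bar R) : coupling mu nu pi ->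
  (\int[pi]_z (enorm (z.1 - z.2) ^+ 2)%:E <= c)%E -> (W2 mu nu <= sqrte c)%E.
Proof.
move=> cpi hc; rewrite /W2 lee_sqrt.
  by apply: (le_trans (ereal_inf_lbound _)) hc; exists pi.
by apply: le_trans hc; apply: integral_ge0 => z _; rewrite lee_fin sqr_ge0.
Qed.

Lemma W2_ge mu nu (c : \bar R) :
  (forall pi, coupling mu nu pi -> (c <= \int[pi]_z (enorm (z.1 - z.2) ^+ 2)%:E)%E) ->
  (sqrte c <= W2 mu nu)%E.
Proof.
move=> hc; rewrite /W2 lee_sqrt.
  by apply: le_ereal_inf_tmp => _ [pi cpi <-]; exact: hc.
apply: le_ereal_inf_tmp => _ [pi cpi <-].
by apply: integral_ge0 => z _; rewrite lee_fin sqr_ge0.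
Qed.

End wasserstein.

Section gaussian_smoothing.
Context (R : realType) (n : nat) d (Omega : measurableType d) (P : probability Omega R).
Context d' (Omega' : measurableType d') (P' : probability Omega' R).
Notation V := 'cV[R]_n.
Variables (X B : {RV P >-> V}) (Y : {RV P' >-> V}) (t : R).
Hypotheses (t0 : 0 < t) (gB : is_gaussian B t) (gY : is_gaussian Y t).
Hypothesis XB : indep X B.

Let gam : probability V R := distribution P' Y.

Let CM a : cameron_martin t gam a.
Proof. by apply: gaussian_cameron_martin => // A mA; exact: gY. Qed.

Let lawB A : measurable A -> distribution P B A = gam A.
Proof.
apply: colvec_measure_unique.
  exact: (eq_ind_r (fun x => (x < +oo)%E) (ltry 1) (probability_setT (distribution P B))).
by move=> {}A mA; rewrite /gam; apply: (eq_trans (gB mA)); apply/esym; exact: gY.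
Qed.

Let integral_lawB (g : V -> \bar R) : (\int[distribution P B]_y g y = \int[gam]_y g y)%E.
Proof. by apply: eq_measure_integral => A mA _; exact: lawB. Qed.

(** Independence identifies the joint law of [X] and [B] with the product measure, to which Tonelli
    applies. *)
Let integral_law_add (g : V -> \bar R) :
  measurable_fun [set: V] g -> (forall y, 0 <= g y)%E ->
  (\int[distribution P (X \+v B)]_y g y = \int[P]_w \int[gam]_y g (y + X w)%R)%E.
Proof.
move=> mg g0.
have mXB : measurable_fun [set: Omega] (fun w => (X w, B w)) by exact: measurable_fun_pair.
pose XBf : {mfun Omega >-> (V * V)%type} := HB.pack (fun w => (X w, B w))
  (isMeasurableFun.Build _ _ _ _ _ mXB).
have mgD : measurable_fun [set: V * V] (fun p => g (p.1 + p.2)%R).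
  by apply: (measurableT_comp mg); exact: measurable_addv.
rewrite ge0_integral_distribution//.
transitivity (\int[distribution P XBf]_p g (p.1 + p.2)%R)%E.
  by rewrite ge0_integral_distribution.
pose lX : probability V R := distribution P X.
transitivity (\int[lX \x gam]_p g (p.1 + p.2)%R)%E.
  apply: eq_measure_integral => A mA _; apply/esym.
  apply: (product_measure_unique (m1 := lX) (m2 := gam)) => // A1 A2 mA1 mA2.
  by apply: (eq_trans (XB mA1 mA2)); congr (_ * _)%E; exact: lawB.
rewrite (fubini_tonelli1 (m1 := lX) (m2 := gam) (fun p => g (p.1 + p.2)%R))//.
have mF := measurable_fun_fubini_tonelli_F (m2 := gam) _ mgD (fun p => g0 _).
rewrite (ge0_integral_distribution _ mF); last first.
  by move=> x; apply: integral_ge0 => y _.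
apply: eq_integral => w _; rewrite /fubini_F/=.
by apply: eq_integral => y _; rewrite addrC.
Qed.

(** Synchronous coupling: [X + B] is paired with [B], which has the law of [Y], and the difference
    is [X]. *)
Lemma W2_smoothing_le_L2norm :
  (W2 (distribution P (X \+v B)) (distribution P' Y) <= L2norm P X)%E.
Proof.
have mXB : measurable_fun [set: Omega] (fun w => ((X \+v B) w, B w)) by exact: measurable_fun_pair.
pose XBf : {mfun Omega >-> (V * V)%type} := HB.pack (fun w => ((X \+v B) w, B w))
  (isMeasurableFun.Build _ _ _ _ _ mXB).
apply: (W2_le (pi := distribution P XBf)).
  apply/couplingP; split=> g mg g0.
    rewrite (ge0_integral_distribution XBf (f := fun z => g z.1))//.
      by rewrite ge0_integral_distribution.
    exact: (measurableT_comp mg).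
  rewrite (ge0_integral_distribution XBf (f := fun z => g z.2))//.
    by rewrite -[RHS]integral_lawB ge0_integral_distribution.
  exact: (measurableT_comp mg).
rewrite ge0_integral_distribution//; last first.
- by move=> z; rewrite lee_fin sqr_ge0.
- exact: measurable_sqr_dist.
rewrite unlock; apply: ge0_le_integral => //.
- by move=> w _; rewrite lee_fin sqr_ge0.
- exact: (measurableT_comp (@measurable_sqr_dist R n) mXB).
- under eq_fun do rewrite enorm_sqr.
  by apply/measurable_EFinP; exact: measurable_dot.
- by move=> w _ /=; rewrite /rv_add addrK.
Qed.

(** In a coupling with the Dirac mass the second point is zero almost surely, so every coupling has
    cost equal to the second moment of [X]. *)
Lemma W2_dirac0 : W2 (distribution P X) \d_(0%R : V) = L2norm P X.
Proof.
have mX2 : measurable_fun [set: V] (fun x : V => (enorm x ^+ 2)%:E).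
  under eq_fun do rewrite enorm_sqr.
  by apply/measurable_EFinP; exact: measurable_dot.
have e0 (x : V) : (0 <= (enorm x ^+ 2)%:E)%E by rewrite lee_fin sqr_ge0.
have LE : ('E_P[fun w => (enorm (X w) ^+ 2)%R] = \int[distribution P X]_x (enorm x ^+ 2)%:E)%E.
  by rewrite unlock ge0_integral_distribution.
apply/eqP; rewrite eq_le; apply/andP; split.
  have mX0 : measurable_fun [set: Omega] (fun w => (X w, 0 : V)) by exact: measurable_fun_pair.
  pose X0 : {mfun Omega >-> (V * V)%type} := HB.pack (fun w => (X w, 0 : V))
    (isMeasurableFun.Build _ _ _ _ _ mX0).
  apply: (W2_le (pi := distribution P X0)).
    apply/couplingP; split=> g mg g0.
      rewrite (ge0_integral_distribution X0 (f := fun z => g z.1))//.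
        by rewrite ge0_integral_distribution.
      exact: (measurableT_comp mg).
    rewrite (ge0_integral_distribution X0 (f := fun z => g z.2))//; last first.
      exact: (measurableT_comp mg).
    rewrite integral_dirac// diracT mul1e /comp/= integral_cst//.
    by rewrite -[RHS]mule1; congr (_ * _)%E; exact: probability_setT.
  rewrite ge0_integral_distribution//; last exact: measurable_sqr_dist.
  rewrite unlock le_eqVlt; apply/orP; left; apply/eqP.
  by apply: eq_integral => w _ /=; rewrite subr0.
apply: W2_ge => pi /couplingP[h1 h2].
rewrite LE -h1// le_eqVlt; apply/orP; left; apply/eqP.
apply: ge0_ae_eq_integral => //.
- exact: (measurableT_comp mX2).
- exact: measurable_sqr_dist.
pose D : set V := ~` [set 0].
have mD : measurable D.
  apply: measurableC.
  have := @measurable_rect R n (fun=> [set 0]).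
  rewrite (_ : mkset _ = [set 0]); first by apply => i.
  apply/seteqP; split => [y/= y0|_ ->] ; last by move=> i; rewrite mxE.
  by apply/matrixP => i j; rewrite (ord1 j) y0 mxE.
have piD : (pi (snd @^-1` D) = 0)%E.
  have mI : measurable_fun [set: V] (fun y => (\1_D y : R)%:E).
    by apply/measurable_EFinP; exact: measurable_indic.
  have m2 : measurable ((snd : V * V -> V) @^-1` D).
    by rewrite -[X in measurable X]setTI; exact: measurable_snd.
  rewrite -(setIT (snd @^-1` D)) -integral_indic//.
  rewrite (h2 (fun y => (\1_D y)%:E))//.
  rewrite integral_dirac// diracT mul1e indicE memNset//=.
  by move=> /(_ erefl).
exists (snd @^-1` D); split => //.
  by rewrite -[X in measurable X]setTI; exact: measurable_snd.
by move=> z /= h z20; apply: h => _; rewrite z20 subr0.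
Qed.

Section bounded.
Variable r : R.
Hypotheses (r0 : 0 < r) (Xr : {ae P, forall w, enorm (X w) <= r}).

Let S : set Omega := [set w | enorm (X w) <= r].

Let measurable_S : measurable S.
Proof.
have mdot : measurable_fun [set: Omega] (fun w => dot (X w) (X w)) by exact: measurable_dot.
have := mdot measurableT `]-oo, r ^+ 2]%classic (measurable_itv _).
rewrite setTI (_ : _ @^-1` _ = S)//; apply/seteqP.
have E1 w : (dot (X w) (X w) <= r ^+ 2) = (enorm (X w) <= r).
  rewrite -enorm_sqr ler_pXn2r// nnegrE ?(ltW r0)//.
  exact: sqrtr_ge0.
by split=> w /=; rewrite in_itv/= E1.
Qed.

(* The bound holds almost surely; truncating makes it hold everywhere. *)
Let X' w : V := (\1_S w : R) *: X w.

Let measurable_X' : measurable_fun [set: Omega] X'.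
Proof. by apply: measurable_scalev => //; exact: measurable_indic. Qed.

Let X'r w : dot (X' w) (X' w) <= r ^+ 2.
Proof.
rewrite /X' dotZl dotZr indicE; case: (boolP (w \in S)) => [|_].
  rewrite inE /S/= !mul1r -enorm_sqr => wS.
  by rewrite lerXn2r// nnegrE ?(ltW r0)//; exact: sqrtr_ge0.
by rewrite !mul0r sqr_ge0.
Qed.

Let aeX' (T : Type) (f : V -> T) : {ae P, forall w, f (X' w) = f (X w)}.
Proof.
apply: filterS Xr => w wS; rewrite /X' indicE mem_set ?scale1r//.
Qed.

Let integral_X' (f : V -> \bar R) : measurable_fun [set: V] f ->
  (\int[P]_w f (X' w) = \int[P]_w f (X w))%E.
Proof.
move=> mf; apply: ae_eq_integral => //.
- exact: (measurableT_comp mf).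
- exact: (measurableT_comp mf).
by apply: filterS (aeX' f) => w + _.
Qed.

Let Sigma := expectation_mx P (fun w => X w *m (X w)^T).

Let mcoordM i j : measurable_fun [set: V] (fun x : V => (x i ord0 * x j ord0)%:E).
Proof.
by apply/measurable_EFinP; apply: measurable_funM; exact: measurable_fun_coord.
Qed.

Let SigmaE i j : \int[P]_w (X' w i ord0 * X' w j ord0) = Sigma i j.
Proof.
rewrite /Rintegral (integral_X' (mcoordM i j)) /Sigma mxE unlock.
by congr fine; apply: eq_integral => w _; rewrite mxE big_ord1 mxE.
Qed.

Let frobeniusE : frobenius Sigma =
  Num.sqrt (\sum_i \sum_j (\int[P]_w (X' w i ord0 * X' w j ord0)) ^+ 2).
Proof.
by rewrite /frobenius; congr Num.sqrt; apply: eq_bigr => i _; apply: eq_bigr => j _; rewrite SigmaE.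
Qed.

Let m := fine 'E_P[fun w => enorm (X w) ^+ 2].

Let bX' i : bounded_mfun (fun w => X' w i ord0).
Proof.
split; first exact: measurable_fun_coord.
by exists r => w; apply: abs_coord_le => //; exact: ltW.
Qed.

Let bdot : bounded_mfun (fun w => dot (X' w) (X' w)).
Proof. by apply: bounded_mfun_sum => i; exact: bounded_mfunM. Qed.

Let msqr : measurable_fun [set: V] (fun x : V => (enorm x ^+ 2)%:E).
Proof.
under eq_fun do rewrite enorm_sqr.
by apply/measurable_EFinP; exact: measurable_dot.
Qed.

Let mE : m = \int[P]_w dot (X' w) (X' w).
Proof.
rewrite /m unlock -(integral_X' msqr); congr fine.
by apply: eq_integral => w _; rewrite enorm_sqr.
Qed.

Lemma second_moment_le : fine 'E_P[fun w => enorm (X w) ^+ 2] <= r ^+ 2.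
Proof.
rewrite -/m mE -[leRHS](Rintegral_cstP P); apply: le_Rintegral => //.
- exact: bounded_mfun_integrable.
- by apply: bounded_mfun_integrable; exact: bounded_mfun_cst.
Qed.

Lemma L2norm_second_moment :
  L2norm P X = (Num.sqrt (fine 'E_P[fun w => enorm (X w) ^+ 2]))%:E.
Proof.
rewrite /L2norm -/m -[in LHS](@fineK _ 'E_P[_])// unlock -(integral_X' msqr).
rewrite (eq_integral (fun w => (dot (X' w) (X' w))%:E)).
  by apply: integrable_fin_num => //; exact: bounded_mfun_integrable.
by move=> w _; rewrite enorm_sqr.
Qed.

(** For independent copies, the squared Frobenius norm is the mean of [<X1, X2>^2], and by
    Cauchy-Schwarz it is at most the mean of [|X1|^2 |X2|^2], the square of the second moment. *)
Lemma frobenius_covariance_le :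
  frobenius (expectation_mx P (fun w => X w *m (X w)^T)) <=
  fine 'E_P[fun w => enorm (X w) ^+ 2].
Proof.
rewrite -/Sigma -/m frobeniusE.
have m0 : 0 <= m by rewrite mE; apply: Rintegral_ge0 => w _; exact: dot_ge0.
rewrite -(ger0_norm m0) -sqrtr_sqr ler_sqrt ?sqr_ge0//.
rewrite -(Rintegral_dot_sqr_prod P measurable_X' r0 X'r) expr2 mE.
rewrite -(Rintegral_prod P bdot bdot).
have bX1 i : bounded_mfun (fun p : Omega * Omega => X' p.1 i ord0).
  have [mf [M fM]] := bX' i; split; first exact: (measurableT_comp mf).
  by exists M => p; exact: fM.
have bX2 i : bounded_mfun (fun p : Omega * Omega => X' p.2 i ord0).
  have [mf [M fM]] := bX' i; split; first exact: (measurableT_comp mf).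
  by exists M => p; exact: fM.
have bd : bounded_mfun (fun p : Omega * Omega => dot (X' p.1) (X' p.2)).
  by apply: bounded_mfun_sum => i; exact: bounded_mfunM.
apply: (@le_Rintegral _ _ _ (P \x P)%E) => //.
- apply: (bounded_mfun_integrable (P \x P)%E).
  by under eq_fun do rewrite expr2; exact: bounded_mfunM.
- apply: (bounded_mfun_integrable (P \x P)%E); apply: bounded_mfunM;
    by apply: bounded_mfun_sum => i; exact: bounded_mfunM.
by move=> p _; exact: dot_cauchy_schwarz.
Qed.

Hypothesis X0 : expectation_mx P X = 0.

Let X'0 i : \int[P]_w (X' w i ord0) = 0.
Proof.
have mc : measurable_fun [set: V] (fun x : V => (x i ord0)%:E).
  by apply/measurable_EFinP; exact: measurable_fun_coord.
rewrite /Rintegral (integral_X' mc).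
by have /matrixP/(_ i ord0) := X0; rewrite !mxE unlock.
Qed.

Let integral_smoothing' (g : V -> \bar R) :
  measurable_fun [set: V] g -> (forall y, 0 <= g y)%E ->
  (\int[distribution P (X \+v B)]_y g y = \int[P]_w \int[gam]_y g (y + X' w)%R)%E.
Proof.
move=> mg g0; apply: (eq_trans (integral_law_add mg g0)); apply/esym.
apply: (integral_X' (f := fun x => \int[gam]_y g (y + x)%R)%E).
apply: (measurable_fun_fubini_tonelli_F (m2 := gam) (fun p => g (p.2 + p.1)%R)) => //.
by apply: (measurableT_comp mg); exact: measurable_addv.
Qed.

(** For each [e > 0], [near_optimal_coupling] is applied to the truncated [X']. The points are
    exchanged because the chain keeps the Gaussian sample in first place. *)
Lemma W2_smoothing_upper : 2 * r ^+ 2 <= t ->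
  (W2 (distribution P (X \+v B)) (distribution P' Y) <=
   ((frobenius Sigma / 2 + 2 * r ^+ 3 / Num.sqrt t) /
     Num.sqrt (t * (1 - r ^+ 2 / (2 * t))))%:E)%E.
Proof.
move=> rt; apply/lee_addgt0Pr => e e0.
have [pi [hpi1 hpi2] cost] := near_optimal_coupling t0 CM measurable_X' r0 X'r X'0 rt e0.
rewrite -frobeniusE in cost; set a := _ / Num.sqrt (t * _) in cost *.
have a0 : 0 <= a.
  rewrite divr_ge0 ?sqrtr_ge0// addr_ge0 ?divr_ge0 ?sqrtr_ge0//.
  by rewrite mulr_ge0// exprn_ge0// ltW.
have mswap : measurable_fun [set: V * V] (fun z : V * V => (z.2, z.1)) by exact: measurable_fun_pair.
pose swapf : {mfun (V * V)%type >-> (V * V)%type} := HB.pack (fun z : V * V => (z.2, z.1))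
  (isMeasurableFun.Build _ _ _ _ _ mswap).
have := @W2_le R n (distribution P (X \+v B)) gam (distribution pi swapf) ((a + e) ^+ 2)%:E.
rewrite /= sqrtr_sqr ger0_norm ?addr_ge0// ?(ltW e0)// EFinD; apply.
  apply/couplingP; split=> g mg g0.
    rewrite (ge0_integral_distribution swapf (f := fun z => g z.1))//; last exact: (measurableT_comp mg).
    rewrite integral_smoothing'//; transitivity (\int[pi]_z g z.2)%E; first by [].
    apply: (eq_trans (hpi2 g mg g0)); apply: eq_integral => w _; apply: eq_integral => y _.
    by rewrite scale1r.
  rewrite (ge0_integral_distribution swapf (f := fun z => g z.2))//; last exact: (measurableT_comp mg).
  exact: (hpi1 g mg g0).
rewrite ge0_integral_distribution//; last 2 first.
- exact: measurable_sqr_dist.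
- by move=> z; rewrite lee_fin sqr_ge0.
apply: le_trans cost; rewrite le_eqVlt; apply/orP; left; apply/eqP.
apply: eq_integral => z _ /=; rewrite enorm_sqr -(opprB z.1) dotNl dotNr opprK//.
Qed.

Lemma W2_smoothing_lower :
  ((frobenius Sigma / Num.sqrt (4 * t + 2 * r ^+ 2))%:E <=
   W2 (distribution P (X \+v B)) (distribution P' Y))%E.
Proof.
have c0 : 0 < 4 * t + 2 * r ^+ 2 by rewrite addr_gt0// mulr_gt0// exprn_gt0.
set F2 := \sum_i \sum_j (\int[P]_w (X' w i ord0 * X' w j ord0)) ^+ 2.
have F20 : 0 <= F2 by apply: sumr_ge0 => i _; apply: sumr_ge0 => j _; exact: sqr_ge0.
have -> : ((frobenius Sigma / Num.sqrt (4 * t + 2 * r ^+ 2))%:E =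
    sqrte (F2 / (4 * t + 2 * r ^+ 2))%:E)%E.
  by rewrite frobeniusE /= sqrtrM// sqrtrV// ltW.
apply: W2_ge => pi /couplingP[h1 h2].
rewrite (eq_integral (fun z : V * V => (dot (z.1 - z.2) (z.1 - z.2))%:E)); last first.
  by move=> z _; rewrite enorm_sqr.
apply: (coupling_lower_bound t0 CM measurable_X' r0 X'r X'0) => // g mg g0.
by rewrite h1// integral_smoothing'.
Qed.

End bounded.

End gaussian_smoothing.

(** * Asymptotics for large T, and dependence on the law of X alone *)

Section limits.
Context (R : realType) (r F : R).

(** [sqrt T] times the bound of [W2_smoothing_upper], in the variable [v = 1 / T]: the limit at
    infinity becomes continuity at zero, which is two-sided since [Num.sqrt] is 0 on negative
    reals. *)
Definition upper_rate (v : R) : R :=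
  (F / 2 + 2 * r ^+ 3 * Num.sqrt v) / Num.sqrt (1 - r ^+ 2 / 2 * v).

Definition lower_rate (v : R) : R := F / Num.sqrt (4 + 2 * r ^+ 2 * v).

Lemma cvg_inv_pinfty : (T : R)^-1 @[T --> +oo] --> (0 : R).
Proof.
apply/(@gtr0_cvgV0 _ _ (pinfty_nbhs R) _ id); last exact: cvg_id.
by near do exact.
Unshelve. all: by end_near. Qed.

Lemma cvg_upper_rate : upper_rate T^-1 @[T --> +oo] --> 2^-1 * F.
Proof.
suff h : upper_rate v @[v --> 0] --> 2^-1 * F.
  exact: (cvg_comp _ _ cvg_inv_pinfty h).
have -> : 2^-1 * F = (F / 2 + 2 * r ^+ 3 * Num.sqrt 0) / Num.sqrt (1 - r ^+ 2 / 2 * 0).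
  by rewrite sqrtr0 !mulr0 addr0 subr0 sqrtr1 divr1 mulrC.
have id0 : (v : R) @[v --> (0 : R)] --> (0 : R) by exact: cvg_id.
apply: cvgM.
  apply: cvgD; first exact: cvg_cst.
  apply: cvgM; first exact: cvg_cst.
  exact: sqrt_continuous.
apply: cvgV; first by rewrite mulr0 subr0 sqrtr1.
apply: (@cvg_comp _ _ _ (fun v => 1 - r ^+ 2 / 2 * v) Num.sqrt); last exact: sqrt_continuous.
apply: cvgB; first exact: cvg_cst.
by apply: cvgM => //; exact: cvg_cst.
Qed.

Lemma cvg_lower_rate : lower_rate T^-1 @[T --> +oo] --> 2^-1 * F.
Proof.
suff h : lower_rate v @[v --> 0] --> 2^-1 * F.
  exact: (cvg_comp _ _ cvg_inv_pinfty h).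
have s4 : Num.sqrt 4 = 2 :> R.
  by rewrite (_ : 4 = 2 ^+ 2) ?sqrtr_sqr ?ger0_norm// -natrX.
have -> : 2^-1 * F = F / Num.sqrt (4 + 2 * r ^+ 2 * 0).
  by rewrite mulr0 addr0 s4 mulrC.
have id0 : (v : R) @[v --> (0 : R)] --> (0 : R) by exact: cvg_id.
apply: cvgM; first exact: cvg_cst.
apply: cvgV; first by rewrite mulr0 addr0 s4.
apply: (@cvg_comp _ _ _ (fun v => 4 + 2 * r ^+ 2 * v) Num.sqrt); last exact: sqrt_continuous.
apply: cvgD; first exact: cvg_cst.
by apply: cvgM => //; exact: cvg_cst.
Qed.

Lemma upper_rateE (t : R) : 0 < t ->
  (F / 2 + 2 * r ^+ 3 / Num.sqrt t) / Num.sqrt (t * (1 - r ^+ 2 / (2 * t))) =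
  upper_rate t^-1 / Num.sqrt t.
Proof.
move=> t0; rewrite /upper_rate sqrtrV ?(ltW t0)// sqrtrM ?(ltW t0)//.
have -> : r ^+ 2 / 2 / t = r ^+ 2 / (2 * t) by rewrite invfM mulrA.
by rewrite invfM mulrCA mulrC.
Qed.

Lemma lower_rateE (t : R) : 0 < t ->
  F / Num.sqrt (4 * t + 2 * r ^+ 2) = lower_rate t^-1 / Num.sqrt t.
Proof.
move=> t0; rewrite /lower_rate.
have -> : 4 * t + 2 * r ^+ 2 = (4 + 2 * r ^+ 2 / t) * t.
  by field; rewrite gt_eqF.
have h : 0 <= 4 + 2 * r ^+ 2 / t.
  by rewrite addr_ge0// divr_ge0 ?(ltW t0)// mulr_ge0// sqr_ge0.
by rewrite sqrtrM// [in LHS]invfM mulrA.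
Qed.

End limits.

(** Lets [frobenius Sigma] be replaced by the second moment, for which the threshold is chosen. *)
Lemma upper_rate_le (R : realType) (r F G v : R) : F <= G ->
  upper_rate r F v <= upper_rate r G v.
Proof.
by move=> FG; rewrite ler_wpM2r ?invr_ge0 ?sqrtr_ge0// lerD2r ler_wpM2r.
Qed.

Section law_transfer.
Context (R : realType) (n : nat) (mu : probability 'cV[R]_n R).
Context d (Omega : measurableType d) (P : probability Omega R) (X : {RV P >-> 'cV[R]_n}).
Hypothesis Xmu : has_law X mu.

(** The threshold is built from [mu] alone, so bounds must pass between [P] and [mu]. The complement
    of the ball is measurable, and has the same mass on both sides. *)
Lemma ae_enorm_law (r : R) :
  {ae P, forall w, enorm (X w) <= r} <-> {ae mu, forall x, enorm x <= r}.
Proof.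
have mC : measurable [set x : 'cV[R]_n | enorm x <= r].
  have me : measurable_fun [set: 'cV[R]_n] (fun x : 'cV[R]_n => enorm x).
    have md : measurable_fun [set: 'cV[R]_n] (fun x : 'cV[R]_n => dot x x) by exact: measurable_dot.
    rewrite (_ : (fun x => _) = (fun x => dot x x `^ 2^-1)).
      exact: (measurableT_comp (measurable_powR _)).
    by apply/funext => x; rewrite powR12_sqrt ?dot_ge0.
  have := me measurableT `]-oo, r]%classic (measurable_itv _).
  by rewrite setTI (_ : _ @^-1` _ = [set x | enorm x <= r])//;
    apply/seteqP; split => x /=; rewrite in_itv.
have mC' := measurableC mC.
have mP : measurable (~` [set w | enorm (X w) <= r]).
  by have := measurable_funPTI X mC'; rewrite preimage_setC.
split=> h.
  apply/(negligibleP mu mC'); rewrite -[LHS]Xmu//.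
  exact: (measure_negligible mP h).
apply/(negligibleP P mP).
have := measure_negligible mC' h; rewrite -[LHS]Xmu//.
Qed.

Lemma second_moment_law :
  ('E_P[fun w => (enorm (X w) ^+ 2)%R] = 'E_mu[fun x => (enorm x ^+ 2)%R])%E.
Proof.
have msqr : measurable_fun [set: 'cV[R]_n] (fun x : 'cV[R]_n => (enorm x ^+ 2)%:E).
  under eq_fun do rewrite enorm_sqr.
  by apply/measurable_EFinP; exact: measurable_dot.
rewrite unlock; transitivity (\int[distribution P X]_x (enorm x ^+ 2)%:E)%E.
  by rewrite ge0_integral_distribution// => x; rewrite lee_fin sqr_ge0.
by apply: eq_measure_integral => A mA _; exact: Xmu.
Qed.

End law_transfer.

Theorem corollary8 (R : realType) (n : nat) (mu : probability 'cV[R]_n R) :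
  exists T0 : R,
  forall (d : measure_display) (Omega : measurableType d)
         (P : probability Omega R)
         (X : {RV P >-> 'cV[R]_n}) (B : R -> {RV P >-> 'cV[R]_n})
         (d' : measure_display) (Omega' : measurableType d')
         (P' : probability Omega' R) (Xhat : R -> {RV P' >-> 'cV[R]_n}),
    has_law X mu ->
    (L2norm P X < +oo)%E ->
    (forall T : R, 0 < T -> is_gaussian (B T) T) ->
    (forall T : R, 0 < T -> indep X (B T)) ->
    (forall T : R, 0 < T -> is_gaussian (Xhat T) T) ->
    let W T := W2 (distribution P (X \+v B T)) (distribution P' (Xhat T)) in
    let Sigma := expectation_mx P (fun w => X w *m (X w)^T) in
    [/\ forall T : R, 0 < T -> (W T <= W2 (distribution P X) \d_(0%R : 'cV[R]_n))%E,
        W2 (distribution P X) \d_(0%R : 'cV[R]_n) = L2norm P X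
      & (exists2 r : R, 0 < r & {ae P, forall w, enorm (X w) <= r}) ->
        expectation_mx P X = 0 ->
        ((Num.sqrt T)%:E * W T)%E @[T --> +oo] --> (2^-1 * frobenius Sigma)%:E
        /\ (forall r : R, 0 < r -> {ae P, forall w, enorm (X w) <= r} ->
            forall T : R, 0 < T -> T0 <= T ->
              (W T <= (r ^+ 2 / Num.sqrt T)%:E)%E)].
Proof.
(* T0 has to be chosen before r: it is built from one bound r valid for mu,
   if there is any, and from the second moment m of mu. *)
pose bounded r := 0 < r /\ {ae mu, forall x, enorm x <= r}.
have [r hr] : exists r, (exists r', bounded r') -> bounded r.
  by have [[r hr]|hn] := pselect (exists r, bounded r); [exists r|exists 0 => /hn].
pose m := fine 'E_mu[fun x => enorm x ^+ 2].
(* The limit of [upper_rate r m] is [m / 2], which is below [m] only for [m > 0]; the case [m = 0]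
   is treated separately. *)
have [T0 hT0] : exists T0, 0 < m -> forall T, 0 < T -> T0 <= T ->
    2 * r ^+ 2 <= T /\ upper_rate r m T^-1 <= m.
  have [m0|m0] := boolP (0 < m); last by exists 0.
  have : \forall T \near +oo, upper_rate r m T^-1 <= m.
    apply: (cvgr_le _ (@cvg_upper_rate R r m)).
    by rewrite gtr_pMl// invf_lt1// ltr1n.
  (* The neighbourhood of infinity contains only [T > A], hence [A + 1]; the other entry is the
     condition under which the upper bound holds. *)
  move=> [A [_ hA]]; exists (Num.max (A + 1) (2 * r ^+ 2)) => _ T _.
  rewrite ge_max => /andP[AT rT]; split=> //; apply: hA.
  by rewrite (lt_le_trans _ AT)// ltrDl.
exists T0 => d Omega P X B d' Omega' P' Xhat Xmu _ gB XB gX /=.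
set Sigma := expectation_mx P (fun w => X w *m (X w)^T).
have dirac := W2_dirac0 X.
have le_L2 T : 0 < T -> (W2 (distribution P (X \+v B T)) (distribution P' (Xhat T)) <= L2norm P X)%E.
  by move=> T_gt0; exact: W2_smoothing_le_L2norm (gB T T_gt0) (gX T T_gt0).
split=> // [T T_gt0|]; first by rewrite dirac; exact: le_L2.
move=> [r1 r10 Xr1] X0.
have upper r2 T : 0 < r2 -> {ae P, forall w, enorm (X w) <= r2} -> 0 < T -> 2 * r2 ^+ 2 <= T ->
    (W2 (distribution P (X \+v B T)) (distribution P' (Xhat T)) <=
     (upper_rate r2 (frobenius Sigma) T^-1 / Num.sqrt T)%:E)%E.
  move=> r20 Xr2 T_gt0 rT; rewrite -upper_rateE//.
  exact: (W2_smoothing_upper T_gt0 (gB T T_gt0) (gX T T_gt0) (XB T T_gt0)).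
split.
  (* Both rates tend to half the Frobenius norm, and they enclose [sqrt T] times the distance as
     soon as [2 r1^2 <= T]. *)
  apply: (@squeeze_cvge _ _ _ _ (fun T => (lower_rate r1 (frobenius Sigma) T^-1)%:E) _
    (fun T => (upper_rate r1 (frobenius Sigma) T^-1)%:E)).
  - near=> T.
    have T_gt0 : 0 < T by near: T; exact: nbhs_pinfty_gt.
    have rT : 2 * r1 ^+ 2 <= T by near: T; apply: nbhs_pinfty_ge; exact: num_real.
    have sT : 0 < Num.sqrt T by rewrite sqrtr_gt0.
    apply/andP; split.
      rewrite -lee_pdivrMl// -EFinM mulrC -lower_rateE//.
      exact: (W2_smoothing_lower T_gt0 (gB T T_gt0) (gX T T_gt0) (XB T T_gt0) r10).
    by rewrite muleC -lee_pdivlMr//; exact: upper.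
  - by apply: cvg_EFin; [exact: nearW|exact: cvg_lower_rate].
  - by apply: cvg_EFin; [exact: nearW|exact: cvg_upper_rate].
move=> r2 r20 Xr2 T T_gt0 T0T.
have sT : 0 < Num.sqrt T by rewrite sqrtr_gt0.
(* Boundedness by [r1] shows that the [r] fixed in advance is a genuine bound for [mu], hence for
   [X]. *)
have [r0 /(ae_enorm_law Xmu) Xr] : bounded r.
  by apply: hr; exists r1; split => //; apply/(ae_enorm_law Xmu).
have mP : fine 'E_P[fun w => enorm (X w) ^+ 2] = m by rewrite (second_moment_law Xmu).
have m_ge0 : 0 <= m by rewrite -mP fine_ge0// unlock integral_ge0// => w _; rewrite lee_fin sqr_ge0.
(* If [m = 0], the L2 norm of [X] is zero and the first inequality already suffices. *)
have [m_eq0|m_neq0] := eqVneq m 0.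
  apply: (le_trans (le_L2 T T_gt0)).
  rewrite (L2norm_second_moment r10 Xr1) mP m_eq0 sqrtr0 lee_fin.
  by rewrite divr_ge0 ?sqr_ge0// ltW.
have m_gt0 : 0 < m by rewrite lt_neqAle eq_sym m_neq0.
have [rT mT] := hT0 m_gt0 T T_gt0 T0T.
(* The estimate uses the fixed [r], on which [T0] was built; the arbitrary [r2] enters only at the
   end, through [m <= r2 ^+ 2]. *)
apply: (le_trans (upper r T r0 Xr T_gt0 rT)).
rewrite lee_fin ler_wpM2r ?invr_ge0 ?(ltW sT)//.
apply: (le_trans (upper_rate_le _ _ (frobenius_covariance_le r0 Xr))).
rewrite mP (le_trans mT)// -mP.
exact: second_moment_le r20 Xr2.
Unshelve. all: by end_near. Qed.
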